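(* Let $\mathfrak R$ be a complete, separated right linear topological ring. Let $\mathfrak F$ be an $\infty$-strictly flat left $\mathfrak R$-contramodule of projective dimension not exceeding $1$ (in the abelian category $\mathfrak R\text{-contra}$). Assume that $\mathfrak F$ has a projective cover in $\mathfrak R\text{-contra}$. Then $\mathfrak F$ is a projective $\mathfrak R$-contramodule.
   Context: Rings are associative and unital. A topological ring $\mathfrak R$ is right linear if its open right ideals form a base of neighborhoods of zero; it is separated and complete if the natural map $\mathfrak R\to\varprojlim_{\mathfrak I}\mathfrak R/\mathfrak I$ ($\mathfrak I$ ranging over the open right ideals) is injective and surjective, respectively. Contramodules. For an abelian group $A$ and a set $X$, $A[X]=A^{(X)}$ is the direct sum of $X$ copies of $A$. For a set $X$, $\mathfrak R[[X]]=\varprojlim_{\mathfrak I}(\mathfrak R/\mathfrak I)[X]\subset\mathfrak R^X$ is the set of all formal linear combinations $\sum_{x\in X}r_xx$ whose family of coefficients converges to zero, i.e., for every open right ideal $\mathfrak I$ the set $\{x: r_x\notin\mathfrak I\}$ is finite. A map $f\colon X\to Y$ induces $\sum_x r_xx\mapsto\sum_y\bigl(\sum_{f(x)=y}r_x\bigr)y$ (infinite sums are limits of finite partial sums in $\mathfrak R$). With the unit $\epsilon_X\colon X\to\mathfrak R[[X]]$, $x\mapsto 1\cdot x$, and the ''opening of parentheses'' map $\phi_X\colon\mathfrak R[[\mathfrak R[[X]]]]\to\mathfrak R[[X]]$ (multiply coefficients and take the convergent sums), $\mathfrak R[[-]]$ is a monad on the category of sets. A left $\mathfrak R$-contramodule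 is an algebra over this monad, i.e., a set $\mathfrak C$ with a contraaction map $\pi_{\mathfrak C}\colon\mathfrak R[[\mathfrak C]]\to\mathfrak C$ satisfying associativity and unitality. Left $\mathfrak R$-contramodules form a cocomplete abelian category $\mathfrak R\text{-contra}$ with enough projectives; the projectives are the direct summands of the free contramodules $\mathfrak R[[X]]$. Strict flatness. A right $\mathfrak R$-module $\mathcal N$ is discrete if the annihilator of every element of $\mathcal N$ is an open right ideal. For a discrete right $\mathfrak R$-module $\mathcal N$ and a left $\mathfrak R$-contramodule $\mathfrak P$, the contratensor product $\mathcal N\odot_{\mathfrak R}\mathfrak P$ is the cokernel of the difference of the two maps $\mathcal N\otimes_{\mathbb Z}\mathfrak R[[\mathfrak P]]\rightrightarrows\mathcal N\otimes_{\mathbb Z}\mathfrak P$ given by $\mathrm{id}\otimes\pi_{\mathfrak P}$ and by $b\otimes\sum_pr_pp\mapsto\sum_pbr_p\otimes p$. Its left derived functors, computed via projective resolutions of the contramodule argument, are denoted $\mathrm{Ctrtor}^{\mathfrak R}_i(\mathcal N,\mathfrak C)$. A left $\mathfrak R$-contramodule $\mathfrak F$ is $n$-strictly flat if $\mathrm{Ctrtor}^{\mathfrak R}_i(\mathcal N,\mathfrak F)=0$ for all discrete right $\mathfrak R$-modules $\mathcal N$ and all $0<i\le n$; it is $\infty$-strictly flat if it is $n$-strictly flat for all $n\ge1$. Covers. For a class of objects $\mathsf L$ in a category, a morphism $l\colon L\to A$ is an $\mathsf L$-precover if $L\in\mathsf L$ and every morphism $L'\to A$ with $L'\in\mathsf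 L$ factors through $l$; an $\mathsf L$-precover $l$ is an $\mathsf L$-cover if every endomorphism $f\colon L\to L$ with $lf=l$ is an automorphism. A projective cover is an $\mathsf L$-cover for $\mathsf L$ the class of projective objects. *)

(* Defs.v *)
From HB Require Import structures.
From mathcomp Require Import all_boot all_algebra finmap.
From mathcomp Require Import boolp classical_sets cardinality fsbigop functions.
From mathcomp Require Import topology tvs summability freeg.

Set Implicit Arguments.
Unset Strict Implicit.
Unset Printing Implicit Defensive.

Import GRing.Theory.
Local Open Scope classical_set_scope.
Local Open Scope ring_scope.
Local Open Scope quotient_scope.

(* [pzRingType] rather than [nzRingType]: the zero ring is allowed.            *)

HB.mixin Record TopologicalZmodule_isTopologicalPzRing R
    & TopologicalZmodule R & GRing.PzRing R := {
  mul_continuous : continuous (fun x : R * R => x.1 * x.2)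
}.

#[short(type="topologicalPzRingType")]
HB.structure Definition TopologicalPzRing :=
  {R of TopologicalZmodule R & GRing.PzRing R
      & TopologicalZmodule_isTopologicalPzRing R}.

Definition right_ideal (R : pzRingType) (I : set R) : Prop :=
  [/\ I 0, (forall a b, I a -> I b -> I (a - b))
         & (forall a r, I a -> I (a * r))].

Definition open_right_ideal (R : topologicalPzRingType) (I : set R) : Prop :=
  open I /\ right_ideal I.

Definition right_linear (R : topologicalPzRingType) : Prop :=
  forall U : set R, nbhs 0 U ->
    exists2 I : set R, open_right_ideal I & I `<=` U.

Definition coset_mod (R : pzRingType) (I : set R) (x : R) : set R :=
  [set y | I (y - x)].

(* A point of the projective limit of the R/I over the open right ideals I:    *)
(* the transition map R/I -> R/J sends a coset of I to the coset of J that     *)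
(* contains it. The values of c outside the open right ideals are irrelevant.  *)
Definition in_quotient_limit (R : topologicalPzRingType)
    (c : set R -> set R) : Prop :=
  (forall I, open_right_ideal I -> exists x, c I = coset_mod I x) /\
  (forall I J, open_right_ideal I -> open_right_ideal J ->
     I `<=` J -> c I `<=` c J).

Definition ring_separated (R : topologicalPzRingType) : Prop :=
  forall x y : R,
    (forall I, open_right_ideal I -> coset_mod I x = coset_mod I y) -> x = y.

Definition ring_complete (R : topologicalPzRingType) : Prop :=
  forall c : set R -> set R, in_quotient_limit c ->
    exists x : R, forall I, open_right_ideal I -> c I = coset_mod I x.

HB.mixin Record TopologicalPzRing_isCompleteRightLinear R
    & TopologicalPzRing R := {
  right_linear_subproof : right_linear R;
  ring_separated_subproof : ring_separated R;
  ring_complete_subproof : ring_complete R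
}.

#[short(type="completeRightLinearRingType")]
HB.structure Definition CompleteRightLinearRing :=
  {R of TopologicalPzRing R & TopologicalPzRing_isCompleteRightLinear R}.

Definition zero_convergent (R : topologicalPzRingType) (X : Type)
    (r : X -> R) : Prop :=
  forall I, open_right_ideal I -> finite_set [set x | ~ I (r x)].

(* The limit of the finite partial sums, indexed by the directed set of finite *)
(* subsets of X; 0 if there is no limit.                                       *)
Definition infsum (R : topologicalPzRingType) (X : Type) (r : X -> R) : R :=
  xget 0 [set s : R |
    (@partial_sum {classic X} R r : {fset {classic X}} -> R) @ totally --> s].

Section infsum_theory.
Variable R : completeRightLinearRingType.

Let ori0 (I : set R) : open_right_ideal I -> I 0.
Proof. by case=> _ []. Qed.

Let oriB (I : set R) a b : open_right_ideal I -> I a -> I b -> I (a - b).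
Proof. by case=> _ [_ + _]; apply. Qed.

Let oriM (I : set R) a r : open_right_ideal I -> I a -> I (a * r).
Proof. by case=> _ [_ _ +]; apply. Qed.

Let oriN (I : set R) a : open_right_ideal I -> I a -> I (- a).
Proof. by move=> oI Ia; rewrite -sub0r; apply: oriB => //; exact: ori0. Qed.

Let oriD (I : set R) a b : open_right_ideal I -> I a -> I b -> I (a + b).
Proof. by move=> oI Ia Ib; rewrite -[b]opprK; apply: oriB => //; exact: oriN. Qed.

Let ori_sum (I : set R) (T : Type) (s : seq T) (P : pred T) (F : T -> R) :
  open_right_ideal I -> (forall x, P x -> I (F x)) ->
  I (\sum_(x <- s | P x) F x).
Proof.
move=> oI IF; elim/big_ind: _ => //; first exact: ori0.
by move=> x y; exact: oriD.
Qed.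

Lemma ori_setI (I J : set R) :
  open_right_ideal I -> open_right_ideal J -> open_right_ideal (I `&` J).
Proof.
move=> oI oJ; split; first by apply: openI; [case: oI|case: oJ].
split; first by split; exact: ori0.
  by move=> a b [Ia Ja] [Ib Jb]; split; exact: oriB.
by move=> a r [Ia Ja]; split; exact: oriM.
Qed.

Lemma nbhs_ori (x : R) (I : set R) : open_right_ideal I ->
  nbhs x (coset_mod I x).
Proof.
move=> oI; apply: open_nbhs_nbhs; split; last first.
  by rewrite /coset_mod /= subrr; exact: ori0.
apply: (@open_comp _ _ (fun y : R => y - x) I); last by case: oI.
move=> y _.
apply: (@continuous_comp _ _ _ (fun z : R => (z, x)) (fun z : R * R => z.1 - z.2)).
  by apply: cvg_pair; [exact: cvg_id|exact: cvg_cst].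
exact: sub_continuous.
Qed.

Lemma nbhs_oriP (x : R) (U : set R) : nbhs x U ->
  exists2 I, open_right_ideal I & coset_mod I x `<=` U.
Proof.
move=> xU; have h : nbhs (0 : R) [set y | U (y + x)].
  have : {for (0 : R), continuous (fun y : R => y + x)}.
    apply: (@continuous_comp _ _ _ (fun z : R => (z, x))
      (fun z : R * R => z.1 + z.2)).
      by apply: cvg_pair; [exact: cvg_id|exact: cvg_cst].
    exact: add_continuous.
  by apply; rewrite add0r.
have [I oI IU] := @right_linear_subproof R _ h; exists I => // y /IU /=.
by rewrite subrK.
Qed.

Lemma cvg_oriP (X : Type) (r : X -> R) (s : R) :
  ((@partial_sum {classic X} R r : {fset {classic X}} -> R) @ totally --> s) <->
  (forall I, open_right_ideal I -> exists A : {fset {classic X}},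
     forall B : {fset {classic X}}, (A `<=` B)%fset ->
       I (\sum_(x <- B) (r : {classic X} -> R) x - s)).
Proof.
split=> [cs I oI|h U /nbhs_oriP[I oI IU]].
  have [A _ AI] := cs _ (nbhs_ori s oI); exists A => B AB.
  by have := AI B AB; rewrite /= /partial_sum big_seq_fsetE.
have [A AI] := h I oI; exists A => // B AB; apply: IU.
by rewrite /= /partial_sum -(big_seq_fsetE _ _ xpredT (r : {classic X} -> R)) /=; exact: AI.
Qed.

Lemma infsum_unique (X : Type) (r : X -> R) (s : R) :
  (forall I, open_right_ideal I -> exists A : {fset {classic X}},
     forall B : {fset {classic X}}, (A `<=` B)%fset ->
       I (\sum_(x <- B) (r : {classic X} -> R) x - s)) ->
  infsum r = s.
Proof.
move=> rs; rewrite /infsum; case: xgetP => [t _ /= /cvg_oriP rt|]; last first.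
  by move=> /(_ s) /=; rewrite cvg_oriP.
apply: ring_separated_subproof => I oI; rewrite /coset_mod.
have [A Ar] := rs I oI; have [B Br] := rt I oI.
have Its : I (t - s).
  have := oriB oI (Ar (A `|` B)%fset (fsubsetUl _ _))
    (Br (A `|` B)%fset (fsubsetUr _ _)).
  by rewrite opprB addrC addrA subrK.
apply/funext => y; apply/propext; split=> /= Iy.
  by rewrite -(subrK t y) -addrA; exact: oriD.
by rewrite -(subrK s y) -addrA -[s - t]opprB; apply: oriB.
Qed.

Lemma infsum_mod (X : Type) (r : X -> R) (I : set R)
    (B : {fset {classic X}}) :
  zero_convergent r -> open_right_ideal I -> (forall x, ~ I (r x) -> x \in B) ->
  I (infsum r - \sum_(x <- B) (r : {classic X} -> R) x).
Proof.
pose rc := (r : {classic X} -> R); move=> zr.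
pose S (J : set R) := fset_set [set x : {classic X} | ~ J (rc x)].
have mem_S J x : open_right_ideal J -> ~ J (rc x) -> x \in S J.
  by move=> oJ nJ; rewrite in_fset_set ?inE//; exact: zr.
have sumS (J : set R) (A : {fset {classic X}}) : open_right_ideal J ->
    (forall x, ~ J (rc x) -> x \in A) ->
    J (\sum_(x <- A) rc x - \sum_(x <- S J) rc x).
  move=> oJ JA.
  have SA : (S J `<=` A)%fset.
    apply/fsubsetP => x; rewrite in_fset_set; last exact: zr.
    by rewrite inE /= => /JA.
  rewrite (big_fsetID _ (mem (S J))) /=.
  have -> : [fset x in A | x \in S J]%fset = S J.
    apply/fsetP => x; rewrite !inE /= andbC; case: (boolP (x \in S J)) => //= xS.
    by rewrite (fsubsetP SA).
  rewrite addrAC subrr add0r big_seq.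
  apply: ori_sum => // x; rewrite !inE /= => /andP[_ xS].
  by apply: contrapT => /(mem_S _ _ oJ); rewrite (negbTE xS).
pose c (J : set R) := coset_mod J (\sum_(x <- S J) rc x).
have [|s sc] := @ring_complete_subproof R c.
  split=> [J _|J K oJ oK JK y]; first by exists (\sum_(x <- S J) rc x).
  rewrite /c /coset_mod /= => /JK Ky.
  rewrite -(subrK (\sum_(x <- S J) rc x) y) -addrA; apply: oriD => //.
  by apply: sumS => // x nK; apply: mem_S => // /JK.
have ss (J : set R) (A : {fset {classic X}}) : open_right_ideal J ->
    (forall x, ~ J (rc x) -> x \in A) -> J (\sum_(x <- A) rc x - s).
  move=> oJ JA; have : coset_mod J s s by rewrite /coset_mod /= subrr; exact: ori0.
  rewrite -sc// /c /coset_mod /= => Js.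
  have -> : \sum_(x <- A) rc x - s =
      (\sum_(x <- A) rc x - \sum_(x <- S J) rc x) - (s - \sum_(x <- S J) rc x).
    by rewrite opprB addrA subrK.
  by apply: oriB => //; exact: sumS.
move=> oI IB; have -> : infsum r = s.
  apply: infsum_unique => J oJ; exists (S J) => A SA; apply: ss => // x nJ.
  by apply: (fsubsetP SA); exact: mem_S.
by rewrite -opprB; apply: oriN => //; exact: ss.
Qed.

Lemma infsum_ori (X : Type) (r : X -> R) (I : set R) :
  zero_convergent r -> open_right_ideal I -> (forall x, I (r x)) ->
  I (infsum r).
Proof.
move=> zr oI Ir; have := @infsum_mod X r I fset0 zr oI.
by rewrite big_seq_fset0 subr0; apply => x /(_ (Ir x)).
Qed.

Lemma infsum1 (X : Type) (r : X -> R) (x : X) :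
  (forall y, y <> x -> r y = 0) -> infsum r = r x.
Proof.
move=> r0; apply: infsum_unique => I oI; exists [fset (x : {classic X})]%fset.
move=> B xB; rewrite (big_fsetD1 (x : {classic X})) /=; last by apply: (fsubsetP xB); rewrite inE.
rewrite big_seq big1 ?addr0 ?subrr; first exact: ori0.
by move=> y; rewrite !inE => /andP[/eqP yx _]; exact: r0.
Qed.

Lemma zero_convergentD (X : Type) (r s : X -> R) : zero_convergent r ->
  zero_convergent s -> zero_convergent (fun x => r x + s x).
Proof.
move=> zr zs I oI; apply: (@sub_finite_set _ _
  ([set x | ~ I (r x)] `|` [set x | ~ I (s x)])); last first.
  by rewrite finite_setU; split; [exact: zr|exact: zs].
move=> x /= nI; have [Ir|] := pselect (I (r x)); last by left.
by right => Is; apply: nI; exact: oriD.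
Qed.

Lemma zero_convergentN (X : Type) (r : X -> R) : zero_convergent r ->
  zero_convergent (fun x => - r x).
Proof.
move=> zr I oI; apply: sub_finite_set (zr I oI) => x /= nI Ir.
by apply: nI; exact: oriN.
Qed.

Lemma zero_convergent0 (X : Type) : zero_convergent (fun _ : X => 0 : R).
Proof.
move=> I oI; apply: sub_finite_set (finite_set0 X) => x /=.
by case; exact: ori0.
Qed.

Lemma infsumD (X : Type) (r s : X -> R) : zero_convergent r ->
  zero_convergent s -> infsum (fun x => r x + s x) = infsum r + infsum s.
Proof.
move=> zr zs; apply: infsum_unique => I oI.
pose A := fset_set ([set x : {classic X} | ~ I (r x)]).
pose B := fset_set ([set x : {classic X} | ~ I (s x)]).
exists (A `|` B)%fset => C ABC; rewrite big_split /= opprD addrACA.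
apply: oriD => //; rewrite -opprB; apply: oriN => //; apply: infsum_mod => // x nI;
  apply: (fsubsetP ABC); rewrite inE.
  by apply/orP; left; rewrite in_fset_set ?inE//; exact: zr.
by apply/orP; right; rewrite in_fset_set ?inE//; exact: zs.
Qed.

Lemma infsumN (X : Type) (r : X -> R) : zero_convergent r ->
  infsum (fun x => - r x) = - infsum r.
Proof.
move=> zr; apply/eqP; rewrite -addr_eq0 -infsumD//; last exact: zero_convergentN.
apply/eqP; apply: infsum_unique => I oI; exists fset0 => B _.
by rewrite big1 ?subr0; [exact: ori0|move=> x _; rewrite addNr].
Qed.

Lemma zero_convergent_push (X Y : Type) (f : X -> Y) (r : X -> R) :
  zero_convergent r ->
  zero_convergent (fun y => infsum (fun x => if `[< f x = y >] then r x else 0)).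
Proof.
move=> zr I oI; apply: (@sub_finite_set _ _ (f @` [set x | ~ I (r x)])).
  move=> y /= nI; apply: contrapT => ny; apply: nI; apply: infsum_ori => //.
    move=> J oJ; apply: sub_finite_set (zr J oJ) => x /=.
    by case: ifP => // _; case; exact: ori0.
  move=> x; case: asboolP => [fxy|_]; last exact: ori0.
  by apply: contrapT => nx; apply: ny; exists x.
by apply: finite_image; exact: zr.
Qed.

Lemma ori_lmul (a : R) (I : set R) : open_right_ideal I ->
  open_right_ideal [set x | I (a * x)].
Proof.
move=> oI; split.
  apply: (@open_comp _ _ (fun y : R => a * y) I); last by case: oI.
  move=> y _; apply: (@continuous_comp _ _ _ (fun z : R => (a, z))
    (fun z : R * R => z.1 * z.2)).
    by apply: cvg_pair; [exact: cvg_cst|exact: cvg_id].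
  exact: mul_continuous.
split=> [|x y Ix Iy|x r Ix] /=; first by rewrite mulr0; exact: ori0.
  by rewrite mulrBr; exact: oriB.
by rewrite mulrA; exact: oriM.
Qed.

Lemma zero_convergent_mulr (X : Type) (r s : X -> R) : zero_convergent r ->
  zero_convergent (fun x => r x * s x).
Proof.
move=> zr I oI; apply: sub_finite_set (zr I oI) => x /= nI Ir.
by apply: nI; exact: oriM.
Qed.

Lemma zero_convergent_join (X Y : Type) (r : Y -> R) (c : Y -> X -> R) :
  zero_convergent r -> (forall y, zero_convergent (c y)) ->
  zero_convergent (fun x => infsum (fun y => r y * c y x)).
Proof.
move=> zr zc I oI; apply: (@sub_finite_set _ _
  (\bigcup_(y in [set y | ~ I (r y)]) [set x | ~ I (r y * c y x)])).
  move=> x /= nI; apply: contrapT => ny; apply: nI; apply: infsum_ori => //.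
    exact: zero_convergent_mulr.
  move=> y; apply: contrapT => nI; apply: ny; exists y => //= Iy.
  by apply: nI; exact: oriM.
apply: bigcup_finite; first exact: zr.
by move=> y _; have := zc y _ (ori_lmul (r y) oI).
Qed.

Lemma zero_convergent_unit (X : Type) (x : X) :
  zero_convergent (fun y => if `[< x = y >] then 1 else 0 : R).
Proof.
move=> I oI; apply: sub_finite_set (finite_set1 x) => y /=.
by case: asboolP => [-> //|_]; case; exact: ori0.
Qed.

Lemma infsum0 (X : Type) : infsum (fun _ : X => 0 : R) = 0.
Proof.
apply: infsum_unique => I oI; exists fset0 => B _.
by rewrite big1 // subr0; exact: ori0.
Qed.

Lemma infsum_exchange_mod (X Y : Type) (h : X -> Y -> R) (I : set R)
    (A : {fset {classic X}}) (B : {fset {classic Y}}) :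
  (forall I, open_right_ideal I -> finite_set [set x | exists y, ~ I (h x y)]) ->
  (forall I, open_right_ideal I -> finite_set [set y | exists x, ~ I (h x y)]) ->
  open_right_ideal I -> (forall x y, ~ I (h x y) -> x \in A) ->
  (forall x y, ~ I (h x y) -> y \in B) ->
  I (infsum (fun x => infsum (h x)) -
     \sum_(x <- A) \sum_(y <- B) (h : {classic X} -> {classic Y} -> R) x y).
Proof.
move=> hX hY oI inA inB.
have zh x : zero_convergent (h x).
  by move=> J oJ; apply: sub_finite_set (hY J oJ) => y /= nJ; exists x.
have zs : zero_convergent (fun x => infsum (h x)).
  move=> J oJ; apply: sub_finite_set (hX J oJ) => x /= nJ.
  apply: contrapT => nx; apply: nJ; apply: infsum_ori => // y.
  by apply: contrapT => nJ; apply: nx; exists y.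
set s := infsum _; set t : R := \sum_(x <- A) _.
pose u : R := \sum_(x <- A) (fun x : {classic X} => infsum (h x)) x.
have -> : s - t = (s - u) + (u - t) by rewrite addrA subrK.
apply: oriD => //.
  apply: infsum_mod => // x nI; apply: contrapT => /negP xA; apply: nI.
  apply: infsum_ori => // y; apply: contrapT => nI.
  by rewrite (inA x y nI) in xA.
rewrite /u /t -sumrB; apply: ori_sum => // x _; apply: infsum_mod => // y.
exact: inB.
Qed.

Lemma infsum_exchange (X Y : Type) (h : X -> Y -> R) :
  (forall I, open_right_ideal I -> finite_set [set x | exists y, ~ I (h x y)]) ->
  (forall I, open_right_ideal I -> finite_set [set y | exists x, ~ I (h x y)]) ->
  infsum (fun x => infsum (h x)) = infsum (fun y => infsum (h^~ y)).
Proof.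
move=> hX hY; apply: ring_separated_subproof => I oI.
pose A := fset_set [set x : {classic X} | exists y, ~ I (h x y)].
pose B := fset_set [set y : {classic Y} | exists x, ~ I (h x y)].
have fA : finite_set [set x : {classic X} | exists y, ~ I (h x y)] := hX I oI.
have fB : finite_set [set y : {classic Y} | exists x, ~ I (h x y)] := hY I oI.
have inA x y : ~ I (h x y) -> x \in A.
  by move=> nI; rewrite (in_fset_set fA) inE /=; exists y.
have inB x y : ~ I (h x y) -> y \in B.
  by move=> nI; rewrite (in_fset_set fB) inE /=; exists x.
have h1 := infsum_exchange_mod hX hY oI inA inB.
have h2 := @infsum_exchange_mod _ _ (fun y x => h x y) I B A hY hX oI
  (fun y x => inB x y) (fun y x => inA x y).
rewrite exchange_big /= in h2.
have h3 := oriB oI h1 h2; rewrite opprB addrA subrK in h3.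
apply/funext => z; rewrite /coset_mod /=; apply/propext; split=> Iz.
  by rewrite -[z](subrK (infsum (fun x => infsum (h x)))) -addrA; exact: oriD.
by rewrite -[z](subrK (infsum (fun y => infsum (h^~ y)))) -addrA -[X in _ + X]opprB;
  apply: oriB.
Qed.

End infsum_theory.

(* [formal_comb R X] is the set R[[X]]; sets are arbitrary types. [comb_unit]  *)
(* and [comb_join] are the unit and the multiplication of the monad R[[-]].    *)

Record formal_comb (R : topologicalPzRingType) (X : Type) := FormalComb {
  coef :> X -> R;
  coef_zero_convergent : zero_convergent coef
}.

Lemma formal_combP (R : topologicalPzRingType) (X : Type)
    (r s : formal_comb R X) : coef r =1 coef s -> r = s.
Proof.
case: r s => [r zr] [s zs] /= /funext rs; subst s.
by congr FormalComb; exact: Prop_irrelevance.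
Qed.

HB.instance Definition _ (R : topologicalPzRingType) (X : Type) :=
  gen_eqMixin (formal_comb R X).
HB.instance Definition _ (R : topologicalPzRingType) (X : Type) :=
  gen_choiceMixin (formal_comb R X).

Section formal_comb_zmodType.
Variables (R : completeRightLinearRingType) (X : Type).

Definition formal_comb0 : formal_comb R X := FormalComb (@zero_convergent0 R X).
Definition formal_combD (r s : formal_comb R X) : formal_comb R X :=
  FormalComb (zero_convergentD (coef_zero_convergent r) (coef_zero_convergent s)).
Definition formal_combN (r : formal_comb R X) : formal_comb R X :=
  FormalComb (zero_convergentN (coef_zero_convergent r)).

Lemma formal_combDA : associative formal_combD.
Proof. by move=> r s t; apply: formal_combP => x /=; exact: addrA. Qed.
Lemma formal_combDC : commutative formal_combD.
Proof. by move=> r s; apply: formal_combP => x /=; exact: addrC. Qed.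
Lemma formal_comb0D : left_id formal_comb0 formal_combD.
Proof. by move=> r; apply: formal_combP => x /=; exact: add0r. Qed.
Lemma formal_combND : left_inverse formal_comb0 formal_combN formal_combD.
Proof. by move=> r; apply: formal_combP => x /=; exact: addNr. Qed.

HB.instance Definition _ := GRing.isZmodule.Build (formal_comb R X)
  formal_combDA formal_combDC formal_comb0D formal_combND.

End formal_comb_zmodType.

Section formal_comb_monad.
Variable R : completeRightLinearRingType.

Definition comb_map (X Y : Type) (f : X -> Y) (r : formal_comb R X) :
    formal_comb R Y :=
  FormalComb (zero_convergent_push f (coef_zero_convergent r)).

Definition comb_unit (X : Type) (x : X) : formal_comb R X :=
  FormalComb (@zero_convergent_unit R X x).

Definition comb_join (X : Type) (t : formal_comb R (formal_comb R X)) :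
    formal_comb R X :=
  FormalComb (zero_convergent_join (coef_zero_convergent t)
    (fun r : formal_comb R X => coef_zero_convergent r)).

Lemma zero_convergent_cond (X : Type) (P : X -> bool) (r : formal_comb R X) :
  zero_convergent (fun x => if P x then r x else 0).
Proof.
move=> I oI; apply: sub_finite_set (coef_zero_convergent r oI) => x /=.
by case: (P x) => //; case; case: oI => _ [].
Qed.

Lemma comb_mapD (X Y : Type) (f : X -> Y) :
  {morph comb_map f : r s / r + s}.
Proof.
move=> r s; apply: formal_combP => y /=.
rewrite -infsumD; [|exact: zero_convergent_cond|exact: zero_convergent_cond].
by congr infsum; apply/funext => x; case: ifP => //; rewrite addr0.
Qed.

Lemma comb_mapN (X Y : Type) (f : X -> Y) : {morph comb_map f : r / - r}.
Proof.
move=> r; apply: formal_combP => y /=.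
rewrite -infsumN; last exact: zero_convergent_cond.
by congr infsum; apply/funext => x; case: ifP => //; rewrite oppr0.
Qed.

Lemma comb_map_unit (X Y : Type) (f : X -> Y) (x : X) :
  comb_map f (comb_unit x) = comb_unit (f x).
Proof.
apply: formal_combP => y /=; rewrite (@infsum1 _ _ _ x) => [|z zx].
  by case: ifP => // _; rewrite asboolT.
by case: ifP => // _; rewrite asboolF// => xz; apply: zx.
Qed.

Lemma comb_joinD (X : Type) : {morph @comb_join X : t u / t + u}.
Proof.
move=> t u; apply: formal_combP => x /=.
rewrite -infsumD; try exact: zero_convergent_mulr (coef_zero_convergent _).
by congr infsum; apply/funext => r; exact: mulrDl.
Qed.

Lemma comb_joinN (X : Type) : {morph @comb_join X : t / - t}.
Proof.
move=> t; apply: formal_combP => x /=.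
rewrite -infsumN; last exact: zero_convergent_mulr (coef_zero_convergent _).
by congr infsum; apply/funext => r; exact: mulNr.
Qed.

Lemma comb_join_unit (X : Type) (r : formal_comb R X) :
  comb_join (comb_unit r) = r.
Proof.
apply: formal_combP => x /=; rewrite (@infsum1 _ _ _ r) => [|s sr].
  by rewrite asboolT// mul1r.
by rewrite asboolF ?mul0r// => rs; apply: sr.
Qed.

End formal_comb_monad.

Record contramodule (R : completeRightLinearRingType) := Contramodule {
  contra_sort :> Type;
  contraact : formal_comb R contra_sort -> contra_sort;
  contraact_assoc : forall t : formal_comb R (formal_comb R contra_sort),
    contraact (comb_map contraact t) = contraact (comb_join t);
  contraact_unit : forall c : contra_sort, contraact (comb_unit R c) = c
}.

Record contra_hom (R : completeRightLinearRingType) (C D : contramodule R) :=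
    ContraHom {
  contra_fun :> C -> D;
  contra_funE : forall r : formal_comb R C,
    contra_fun (contraact r) = contraact (comb_map contra_fun r)
}.

Arguments contraact {R} {_} r : rename.

HB.instance Definition _ (R : completeRightLinearRingType)
  (C : contramodule R) := gen_eqMixin (contra_sort C).
HB.instance Definition _ (R : completeRightLinearRingType)
  (C : contramodule R) := gen_choiceMixin (contra_sort C).

(* The underlying abelian group: x + y is the value of the contraaction on the *)
(* formal combination 1 x + 1 y, and similarly for 0 and - x.                  *)
Section contra_zmodType.
Variables (R : completeRightLinearRingType) (C : contramodule R).

Definition contra0 : C := contraact 0.
Definition contraD (x y : C) : C :=
  contraact (comb_unit R x + comb_unit R y).
Definition contraN (x : C) : C := contraact (- comb_unit R x).

Lemma contraDE (r s : formal_comb R C) :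
  contraD (contraact r) (contraact s) = contraact (r + s).
Proof.
have := contraact_assoc (comb_unit R r + comb_unit R s).
by rewrite comb_mapD comb_joinD !comb_map_unit !comb_join_unit.
Qed.

Lemma contraNE (r : formal_comb R C) :
  contraN (contraact r) = contraact (- r).
Proof.
have := contraact_assoc (- comb_unit R r).
by rewrite comb_mapN comb_joinN !comb_map_unit !comb_join_unit.
Qed.

Lemma contraDA : associative contraD.
Proof.
move=> x y z; rewrite -(contraact_unit x) -(contraact_unit y) -(contraact_unit z).
by rewrite !contraDE addrA.
Qed.

Lemma contraDC : commutative contraD.
Proof. by move=> x y; rewrite /contraD addrC. Qed.

Lemma contra0D : left_id contra0 contraD.
Proof. by move=> x; rewrite -(contraact_unit x) contraDE add0r. Qed.

Lemma contraND : left_inverse contra0 contraN contraD.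
Proof.
by move=> x; rewrite -(contraact_unit x) contraNE contraDE addNr.
Qed.

HB.instance Definition _ := GRing.isZmodule.Build (contra_sort C)
  contraDA contraDC contra0D contraND.

Lemma contraactD : {morph (@contraact R C) : r s / r + s}.
Proof. by move=> r s; exact: esym (contraDE r s). Qed.

End contra_zmodType.

Section contra_category.
Variable R : completeRightLinearRingType.

Lemma contra_homP (C D : contramodule R) (f g : contra_hom C D) :
  f =1 g -> f = g.
Proof.
case: f g => [f fE] [g gE] /= /funext fg; subst g.
by congr ContraHom; exact: Prop_irrelevance.
Qed.

Lemma contra_homD (C D : contramodule R) (f : contra_hom C D) :
  {morph f : x y / x + y}.
Proof.
move=> x y; rewrite [x + y]/(contraact _) contra_funE comb_mapD.
by rewrite !comb_map_unit.
Qed.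

Lemma comb_map_id (X : Type) (r : formal_comb R X) : comb_map id r = r.
Proof.
apply: formal_combP => x /=; rewrite (@infsum1 _ _ _ x) => [|y yx].
  by rewrite asboolT.
by rewrite asboolF.
Qed.

Lemma comb_map_comp (X Y Z : Type) (g : Y -> Z) (f : X -> Y)
    (r : formal_comb R X) :
  comb_map g (comb_map f r) = comb_map (g \o f) r.
Proof.
apply: formal_combP => z /=; pose h y x : R :=
  if `[< g y = z >] then if `[< f x = y >] then r x else 0 else 0.
transitivity (infsum (fun y => infsum (h y))).
  congr infsum; apply/funext => y; rewrite /h.
  by case: ifP => // _; rewrite infsum0.
have hr (I : set R) x y : I 0 -> ~ I (h y x) -> f x = y /\ ~ I (r x).
  move=> I0; rewrite /h; case: ifP => // _.
  by case: ifP => [/asboolP|//].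
rewrite infsum_exchange => [|I oI|I oI].
- congr infsum; apply/funext => x; rewrite (@infsum1 _ _ _ (f x)) /h.
    by rewrite [in X in (if _ then X else _)]asboolT.
  by move=> y yfx; case: ifP => // _; rewrite asboolF// => fxy; apply: yfx.
- have I0 : I 0 by case: oI => _ [].
  apply: (@sub_finite_set _ _ (f @` [set x | ~ I (r x)])).
    by move=> y /= [x /(hr _ _ _ I0)[<- nI]]; exists x.
  exact: finite_image (coef_zero_convergent r oI).
- have I0 : I 0 by case: oI => _ [].
  apply: sub_finite_set (coef_zero_convergent r oI) => x /= [y].
  by move=> /(hr _ _ _ I0)[].
Qed.

Definition contra_id (C : contramodule R) : contra_hom C C :=
  @ContraHom R C C id (fun r => congr1 contraact (esym (comb_map_id r))).

Lemma contra_comp_subproof (C D E : contramodule R) (g : contra_hom D E)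
    (f : contra_hom C D) (r : formal_comb R C) :
  g (f (contraact r)) = contraact (comb_map (g \o f) r).
Proof. by rewrite !contra_funE comb_map_comp. Qed.

Definition contra_comp (C D E : contramodule R) (g : contra_hom D E)
    (f : contra_hom C D) : contra_hom C E :=
  ContraHom (contra_comp_subproof g f).

Definition contra_epi (C D : contramodule R) (f : contra_hom C D) : Prop :=
  forall (E : contramodule R) (g h : contra_hom D E),
    contra_comp g f = contra_comp h f -> g = h.

Definition contra_projective (P : contramodule R) : Prop :=
  forall (C D : contramodule R) (e : contra_hom C D), contra_epi e ->
    forall f : contra_hom P D, exists g : contra_hom P C, contra_comp e g = f.

Definition contra_precover (L : contramodule R -> Prop) (P A : contramodule R)
    (l : contra_hom P A) : Prop :=
  L P /\ forall (P' : contramodule R) (f : contra_hom P' A), L P' ->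
    exists g : contra_hom P' P, contra_comp l g = f.

Definition contra_automorphism (P : contramodule R) (f : contra_hom P P) : Prop :=
  exists g : contra_hom P P,
    contra_comp g f = contra_id P /\ contra_comp f g = contra_id P.

Definition contra_cover (L : contramodule R -> Prop) (P A : contramodule R)
    (l : contra_hom P A) : Prop :=
  contra_precover L l /\
  forall f : contra_hom P P, contra_comp l f = l -> contra_automorphism f.

Definition has_projective_cover (A : contramodule R) : Prop :=
  exists (P : contramodule R) (l : contra_hom P A), contra_cover contra_projective l.

(* Kernels and images in the abelian category of contramodules are computed on *)
(* the underlying abelian groups, so exactness is stated elementwise.          *)
Record projective_resolution (C : contramodule R) := ProjectiveResolution {
  res_obj :> nat -> contramodule R;
  res_diff : forall n, contra_hom (res_obj n.+1) (res_obj n);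
  res_aug : contra_hom (res_obj 0) C;
  res_projective : forall n, contra_projective (res_obj n);
  res_aug_surj : forall c : C, exists x, res_aug x = c;
  res_exact0 : forall x : res_obj 0,
    res_aug x = 0 <-> exists y, res_diff 0 y = x;
  res_exactS : forall n (x : res_obj n.+1),
    res_diff n x = 0 <-> exists y, res_diff n.+1 y = x
}.

Definition projective_dimension_le (C : contramodule R) (n : nat) : Prop :=
  exists P : projective_resolution C,
    forall k, (n < k)%N -> forall x : P k, x = 0.

End contra_category.

Definition subgroup (V : zmodType) (H : set V) : Prop :=
  H 0 /\ forall x y, H x -> H y -> H (x - y).

Definition generated (V : zmodType) (S : set V) : {pred V} :=
  fun v => `[< forall H : set V, subgroup H -> S `<=` H -> H v >].

Lemma generated_zmod_closed (V : zmodType) (S : set V) :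
  zmod_closed (generated S).
Proof.
split=> [|x y]; first by apply/asboolP => H [].
move=> /asboolP xS /asboolP yS; apply/asboolP => H gH SH.
by apply: gH.2; [exact: xS|exact: yS].
Qed.

HB.instance Definition _ (V : zmodType) (S : set V) :=
  GRing.isZmodClosed.Build V (generated S) (generated_zmod_closed S).

Definition quotient_by (V : zmodType) (S : set V) : Type :=
  Quotient.quot (generated S : zmodClosed V).

HB.instance Definition _ (V : zmodType) (S : set V) :=
  Choice.on (quotient_by S).
HB.instance Definition _ (V : zmodType) (S : set V) :=
  GRing.Zmodule.on (quotient_by S).

Section quotient_by.
Variables (V : zmodType) (S : set V).

Definition quotient_pi (v : V) : quotient_by S :=
  \pi_(Quotient.quot (generated S : zmodClosed V)) v.

Lemma quotient_piB : {morph quotient_pi : x y / x - y}.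
Proof. by move=> x y; rewrite /quotient_pi raddfB. Qed.

HB.instance Definition _ :=
  GRing.isZmodMorphism.Build V (quotient_by S) quotient_pi quotient_piB.

Lemma quotient_pi_eq (x y : V) :
  quotient_pi x = quotient_pi y <-> generated S (x - y).
Proof.
rewrite /quotient_pi; split=> [/eqP|gS]; first by rewrite -Quotient.idealrBE.
by apply/eqP; rewrite -Quotient.idealrBE.
Qed.

Lemma quotient_pi0 (s : V) : S s -> quotient_pi s = 0.
Proof.
move=> Ss; rewrite -(raddf0 quotient_pi); apply/quotient_pi_eq; rewrite subr0.
by apply/asboolP => H _; exact.
Qed.

(* The map induced by f; meaningful when f is additive and vanishes on S.      *)
Definition quotient_lift (W : zmodType) (f : V -> W) (q : quotient_by S) : W :=
  f (repr (q : Quotient.quot (generated S : zmodClosed V))).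

Lemma quotient_liftE (W : zmodType) (f : V -> W) :
  {morph f : x y / x - y} -> (forall s, S s -> f s = 0) ->
  forall v, quotient_lift f (quotient_pi v) = f v.
Proof.
move=> fB fS v; rewrite /quotient_lift.
set w := repr _; have : quotient_pi w = quotient_pi v.
  by rewrite /quotient_pi /w reprK.
move=> /quotient_pi_eq /asboolP /(_ [set x | f x = 0]) /= h.
apply/eqP; rewrite -subr_eq0 -fB; apply/eqP; apply: h => //.
split=> /= [|x y fx fy]; first by rewrite -(subrr 0) fB subrr.
by rewrite fB fx fy subrr.
Qed.

Lemma quotient_pi_surj (q : quotient_by S) : exists v, q = quotient_pi v.
Proof.
by exists (repr (q : Quotient.quot (generated S : zmodClosed V)));
  rewrite /quotient_pi reprK.
Qed.

Lemma quotient_liftB (W : zmodType) (f : V -> W) :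
  {morph f : x y / x - y} -> (forall s, S s -> f s = 0) ->
  {morph quotient_lift f : x y / x - y}.
Proof.
move=> fB fS q r; have [v ->] := quotient_pi_surj q.
have [w ->] := quotient_pi_surj r.
by rewrite -quotient_piB !quotient_liftE.
Qed.

End quotient_by.

Section tensor.
Variables A B : zmodType.

Definition tensor_relations : set {freeg (A * B)%type / int} :=
  [set t | (exists a a' b, t = << (a + a', b) >> - << (a, b) >> - << (a', b) >>) \/
           (exists a b b', t = << (a, b + b') >> - << (a, b) >> - << (a, b') >>)].

Definition tensor : Type := quotient_by tensor_relations.
HB.instance Definition _ := GRing.Zmodule.on tensor.

Definition tens (a : A) (b : B) : tensor := quotient_pi _ << (a, b) >>.

Lemma tensDl (a a' : A) (b : B) : tens (a + a') b = tens a b + tens a' b.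
Proof.
apply/eqP; rewrite -subr_eq0 opprD addrA -!raddfB; apply/eqP.
by apply: quotient_pi0; left; exists a, a', b.
Qed.

Lemma tensDr (a : A) (b b' : B) : tens a (b + b') = tens a b + tens a b'.
Proof.
apply/eqP; rewrite -subr_eq0 opprD addrA -!raddfB; apply/eqP.
by apply: quotient_pi0; right; exists a, b, b'.
Qed.

Lemma tens0l (b : B) : tens 0 b = 0.
Proof. by apply: (addrI (tens 0 b)); rewrite -tensDl !addr0. Qed.

Lemma tens_suml (I : Type) (s : seq I) (F : I -> A) (b : B) :
  tens (\sum_(i <- s) F i) b = \sum_(i <- s) tens (F i) b.
Proof. by apply: (big_morph (tens^~ b)) => [a a'|]; [exact: tensDl|exact: tens0l]. Qed.

(* The map induced by f; meaningful when f is biadditive. [zmodule W] is W     *)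
(* seen as a module over the integers.                                         *)
Definition tensor_lift (W : zmodType) (f : A -> B -> W) : tensor -> W :=
  @quotient_lift _ tensor_relations W
    (fglift (fun ab : A * B => f ab.1 ab.2 : zmodule W)).

Definition biadditive (W : zmodType) (f : A -> B -> W) : Prop :=
  (forall a a' b, f (a + a') b = f a b + f a' b) /\
  (forall a b b', f a (b + b') = f a b + f a b').

Section lift.
Variables (W : zmodType) (f : A -> B -> W).
Hypothesis fD : biadditive f.

Let F (t : {freeg (A * B)%type / int}) : W :=
  fglift (fun ab : A * B => f ab.1 ab.2 : zmodule W) t.

Let FB : {morph F : x y / x - y}.
Proof. exact: (lift_is_additive (M := zmodule W) (fun ab : A * B => f ab.1 ab.2)). Qed.

Let FU a b : F << (a, b) >> = f a b.
Proof. by rewrite /F liftU scale1r. Qed.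

Let F0 t : tensor_relations t -> F t = 0.
Proof.
case=> [[a [a' [b ->]]]|[a [b [b' ->]]]]; rewrite !FB !FU.
  by rewrite fD.1 addrAC addrK subrr.
by rewrite fD.2 addrAC addrK subrr.
Qed.

Lemma tensor_liftE a b : tensor_lift f (tens a b) = f a b.
Proof. by rewrite -FU; exact: (quotient_liftE FB F0). Qed.

Lemma tensor_liftB : {morph tensor_lift f : x y / x - y}.
Proof. exact: (quotient_liftB FB F0). Qed.

End lift.

Lemma tensor_lift_sum (W : zmodType) (f : A -> B -> W) (I : Type) (s : seq I)
    (F : I -> tensor) : biadditive f ->
  tensor_lift f (\sum_(i <- s) F i) = \sum_(i <- s) tensor_lift f (F i).
Proof.
move=> fD; have lB := tensor_liftB fD.
have l0 : tensor_lift f 0 = 0 by rewrite -(subrr (0 : tensor)) lB subrr.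
have lN x : tensor_lift f (- x) = - tensor_lift f x by rewrite -[- x]sub0r lB l0 sub0r.
have lD x y : tensor_lift f (x + y) = tensor_lift f x + tensor_lift f y.
  by rewrite -[y in LHS]opprK lB lN opprK.
exact: (big_morph _ lD l0).
Qed.

Lemma tensor_ind (P : tensor -> Prop) :
  P 0 -> (forall x y, P x -> P y -> P (x - y)) ->
  (forall a b, P (tens a b)) -> forall t, P t.
Proof.
move=> P0 PB Pt t; have [v ->] := quotient_pi_surj t.
have PN x : P x -> P (- x) by rewrite -sub0r; exact: PB.
have PD x y : P x -> P y -> P (x + y).
  by move=> Px Py; rewrite -[y]opprK; apply: PB => //; exact: PN.
rewrite -(freeg_sumE v) raddf_sum; elim/big_ind: _ => // -[a b] _ /=.
have -> : << coeff (a, b) v *g (a, b) >> = << (a, b) >> *~ coeff (a, b) v.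
  by rewrite freegU_mulz intz.
rewrite raddfMz /=.
have PM x n : P x -> P (x *+ n).
  by move=> Px; elim: n => [|n IH]; [rewrite mulr0n|rewrite mulrS; exact: PD].
rewrite -/(tens a b); case: (coeff _ _) => n; [exact: PM|apply: PN; exact: PM].
Qed.

End tensor.

(* A right R-module is a left module over the opposite ring R^c.               *)

Definition ract (R : pzRingType) (N : lmodType R^c) (b : N) (r : R) : N :=
  (r : R^c) *: b.

Definition annihilator (R : pzRingType) (N : lmodType R^c) (b : N) : set R :=
  [set r | ract b r = 0].

Definition discrete_module (R : topologicalPzRingType) (N : lmodType R^c) :
    Prop :=
  forall b : N, open_right_ideal (annihilator b).

Section contratensor.
Variables (R : completeRightLinearRingType) (N : lmodType R^c).

(* The two maps N (x) R[[P]] -> N (x) P. The sum over p below has only finitely *)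
(* many nonzero terms when N is discrete.                                      *)
Definition contratensor_act (P : contramodule R) :
    tensor N (formal_comb R P) -> tensor N P :=
  tensor_lift (fun (b : N) (r : formal_comb R P) => tens b (contraact r)).

Definition contratensor_expand (P : contramodule R) :
    tensor N (formal_comb R P) -> tensor N P :=
  tensor_lift (fun (b : N) (r : formal_comb R P) =>
    \sum_(p \in [set: P]) tens (ract b (r p)) p).

(* The image of an additive map is a subgroup, so dividing by the subgroup     *)
(* generated by the range gives the cokernel of the difference.                *)
Definition contratensor (P : contramodule R) : Type :=
  quotient_by
    (range (fun t => @contratensor_act P t - @contratensor_expand P t)).
HB.instance Definition _ (P : contramodule R) :=
  GRing.Zmodule.on (contratensor P).

(* The map N (.) f induced by id (x) f; see [contratensor_mapE].               *)
Definition contratensor_map (P Q : contramodule R) (f : contra_hom P Q) :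
    contratensor P -> contratensor Q :=
  quotient_lift (fun t : tensor N P =>
    quotient_pi _ (tensor_lift (fun (b : N) (p : P) => tens b (f p)) t)
      : contratensor Q).

Definition contratens (P : contramodule R) (b : N) (p : P) : contratensor P :=
  quotient_pi _ (tens b p).

Lemma ractBr (b : N) (r s : R) : ract b (r - s) = ract b r - ract b s.
Proof. exact: scalerBl. Qed.

Lemma ract_sumr (I : Type) (t : seq I) (F : I -> R) (b : N) :
  ract b (\sum_(i <- t) F i) = \sum_(i <- t) ract b (F i).
Proof. exact: scaler_suml. Qed.

Hypothesis discN : discrete_module N.

Lemma contratensor_expand_sum (P : contramodule R) (b : N) (r : formal_comb R P)
    (A : {fset P}) : (forall p, p \notin A -> ract b (r p) = 0) ->
  \sum_(p \in [set: P]) tens (ract b (r p)) p =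
  \sum_(p <- A) tens (ract b (r p)) p.
Proof. by move=> bA; apply: fsbigTE => p /bA ->; exact: tens0l. Qed.

Lemma ract_support (P : contramodule R) (b : N) (r : formal_comb R P) :
  exists A : {fset P}, forall p, p \notin A -> ract b (r p) = 0.
Proof.
have fA := coef_zero_convergent r (discN b).
exists (fset_set [set p : P | ~ annihilator b (r p)]) => p.
by rewrite (in_fset_set (fA : finite_set ([set p : P | _] : set P))) notin_setE
  /= => /contrapT.
Qed.

Lemma contratensor_act_biadditive (P : contramodule R) :
  biadditive (fun (b : N) (r : formal_comb R P) => tens b (contraact r)).
Proof.
split=> [b b' r|b r s]; first exact: tensDl.
by rewrite contraactD tensDr.
Qed.

Lemma contratensor_expand_biadditive (P : contramodule R) :
  biadditive (fun (b : N) (r : formal_comb R P) =>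
    \sum_(p \in [set: P]) tens (ract b (r p)) p).
Proof.
split=> [b b' r|b r s].
  have [A bA] := ract_support b r; have [B bB] := ract_support b' r.
  have hA p : p \notin (A `|` B)%fset -> ract b (r p) = 0.
    by rewrite inE negb_or => /andP[/bA].
  have hB p : p \notin (A `|` B)%fset -> ract b' (r p) = 0.
    by rewrite inE negb_or => /andP[_ /bB].
  have D p : ract (b + b') (r p) = ract b (r p) + ract b' (r p).
    exact: scalerDr.
  rewrite (contratensor_expand_sum hA) (contratensor_expand_sum hB).
  rewrite (@contratensor_expand_sum _ _ _ (A `|` B)%fset) => [|p pAB].
    by rewrite -big_split; apply: eq_bigr => p _ /=; rewrite D tensDl.
  by rewrite D hA// hB// addr0.
have [A bA] := ract_support b r; have [B bB] := ract_support b s.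
have hA p : p \notin (A `|` B)%fset -> ract b (r p) = 0.
  by rewrite inE negb_or => /andP[/bA].
have hB p : p \notin (A `|` B)%fset -> ract b (s p) = 0.
  by rewrite inE negb_or => /andP[_ /bB].
have D p : ract b ((r + s) p) = ract b (r p) + ract b (s p).
  exact: scalerDl.
rewrite (contratensor_expand_sum hA) (contratensor_expand_sum hB).
rewrite (@contratensor_expand_sum _ _ _ (A `|` B)%fset) => [|p pAB].
  by rewrite -big_split; apply: eq_bigr => p _ /=; rewrite D tensDl.
by rewrite D hA// hB// addr0.
Qed.

Section map.
Variables (P Q : contramodule R) (f : contra_hom P Q).

Let idf : N -> P -> tensor N Q := fun b p => tens b (f p).

Let idfD : biadditive idf.
Proof.
split=> [b b' p|b p q]; first exact: tensDl.
by rewrite /idf contra_homD tensDr.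
Qed.

Lemma contratensor_expand_map (b : N) (r : formal_comb R P) :
  tensor_lift idf (\sum_(p \in [set: P]) tens (ract b (r p)) p) =
  \sum_(q \in [set: Q]) tens (ract b (comb_map f r q)) q.
Proof.
have [A bA] := ract_support b r.
rewrite (contratensor_expand_sum bA) tensor_lift_sum//.
have mapE q : ract b (comb_map f r q) =
    \sum_(p <- A) (if f p == q then ract b (r p) else 0).
  pose g : P -> R := fun p => if `[< f p = q >] then r p else 0.
  have h : annihilator b (infsum g - \sum_(p <- A) g p).
    apply: infsum_mod => //; first exact: zero_convergent_cond.
    move=> p nb; apply: contrapT => /negP pA; apply: nb.
    rewrite /g /annihilator /=; case: ifP => _; first exact: bA.
    exact: scale0r.
  move: h; rewrite /annihilator /= ractBr => /eqP; rewrite subr_eq0 => /eqP.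
  rewrite ract_sumr => ->; apply: eq_bigr => p _; rewrite /g.
  have -> : `[< f p = q >] = (f p == q) by apply/asboolP/eqP.
  by case: ifP => // _; exact: scale0r.
rewrite (@contratensor_expand_sum _ _ _ [fset f p | p in A]%fset) => [|q qA].
  under [RHS]eq_bigr => q _ do rewrite (mapE q) tens_suml.
  rewrite exchange_big /= big_seq [RHS]big_seq; apply: eq_bigr => p pA.
  rewrite tensor_liftE// (big_fsetD1 (f p)) /=; last exact: in_imfset.
  rewrite eqxx big_seq big1 ?addr0// => q; rewrite !inE => /andP[qp _].
  by rewrite eq_sym (negbTE qp) tens0l.
rewrite mapE big_seq big1// => p pA; case: eqP => // fpq; case/negP: qA.
by rewrite -fpq; exact: in_imfset.
Qed.

Let F (t : tensor N P) : contratensor Q := quotient_pi _ (tensor_lift idf t).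

Let FB : {morph F : x y / x - y}.
Proof. by move=> x y; rewrite /F tensor_liftB// raddfB. Qed.

Let F0 s : range (fun t => @contratensor_act P t - @contratensor_expand P t) s ->
  F s = 0.
Proof.
case=> t _ <-; rewrite FB.
pose D t := F (contratensor_act t) - F (contratensor_expand t).
have DB : {morph D : x y / x - y}.
  move=> x y; rewrite /D /contratensor_act /contratensor_expand.
  rewrite !tensor_liftB ?FB; first last.
  - exact: contratensor_act_biadditive.
  - exact: contratensor_expand_biadditive.
  by rewrite !opprD !opprK addrACA.
rewrite -/(D t); elim/tensor_ind: t => [|x y Dx Dy|b r].
- by rewrite -(subrr 0) DB subrr.
- by rewrite DB Dx Dy subrr.
rewrite /D /contratensor_act /contratensor_expand !tensor_liftE; first last.
- exact: contratensor_act_biadditive.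
- exact: contratensor_expand_biadditive.
rewrite -FB /F; apply: quotient_pi0; exists (tens b (comb_map f r)) => //.
rewrite tensor_liftB// contratensor_expand_map tensor_liftE// /idf contra_funE.
rewrite /contratensor_act /contratensor_expand !tensor_liftE //.
- exact: contratensor_expand_biadditive.
- exact: contratensor_act_biadditive.
Qed.

Lemma contratensor_mapE (b : N) (p : P) :
  contratensor_map f (contratens b p) = contratens b (f p).
Proof.
by apply: etrans (quotient_liftE FB F0 _) _; rewrite /F tensor_liftE.
Qed.

Lemma contratensor_mapB : {morph contratensor_map f : x y / x - y}.
Proof. exact: (quotient_liftB FB F0). Qed.

End map.

End contratensor.

Arguments contratensor_map {R} N {P Q} f.

Definition contratensor_cycle (R : completeRightLinearRingType)
    (N : lmodType R^c) (C : contramodule R) (P : projective_resolution C)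
    (i : nat) : contratensor N (P i) -> Prop :=
  match i with
  | 0 => fun _ => True
  | j.+1 => fun x => contratensor_map N (res_diff P j) x = 0
  end.

Definition contratensor_boundary (R : completeRightLinearRingType)
    (N : lmodType R^c) (C : contramodule R) (P : projective_resolution C)
    (i : nat) (x : contratensor N (P i)) : Prop :=
  exists y : contratensor N (P i.+1), contratensor_map N (res_diff P i) y = x.

(* Ctrtor_i(N, C) is the i-th homology group of the complex N (.) P for a      *)
(* projective resolution P of C, and its vanishing is tested on one P: by the  *)
(* comparison theorem the homology does not depend on P up to isomorphism.     *)
Definition Ctrtor_vanishes (R : completeRightLinearRingType) (i : nat)
    (N : lmodType R^c) (C : contramodule R) : Prop :=
  exists P : projective_resolution C,
    forall x : contratensor N (P i),
      contratensor_cycle x -> contratensor_boundary x.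

Definition strictly_flat (R : completeRightLinearRingType) (n : nat)
    (F : contramodule R) : Prop :=
  forall N : lmodType R^c, discrete_module N ->
    forall i : nat, (0 < i <= n)%N -> Ctrtor_vanishes i N F.

Definition infinitely_strictly_flat (R : completeRightLinearRingType)
    (F : contramodule R) : Prop :=
  forall n : nat, (1 <= n)%N -> strictly_flat n F.

(* Main.v *)
(* Let l : P -> F be a projective cover with kernel K, which is projective since
   pd F <= 1. If R/m is a simple discrete right module, then
   (R/m) (.) K -> (R/m) (.) P is injective by strict flatness. It is also zero:
   for k in K and c : P -> R, the endomorphism p |-> c(p) r k of P takes values
   in K, so the cover property makes 1 - c(k) r invertible for all r, and
   c(k) acts by zero on R/m. Hence (R/m) (.) K = 0 for all m; Nakayama's
   lemma for finitely generated discrete right modules then gives K = 0. *)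
From HB Require Import structures.
From mathcomp Require Import all_boot all_algebra finmap.
From mathcomp Require Import boolp classical_sets cardinality.
From mathcomp Require Import topology.
Require Import Defs.

Set Implicit Arguments.
Unset Strict Implicit.
Unset Printing Implicit Defensive.

Import GRing.Theory.
Local Open Scope classical_set_scope.
Local Open Scope ring_scope.

(** * Right ideals and multiples of infinite sums *)

Lemma morphB0 (V W : zmodType) (f : V -> W) :
  {morph f : x y / x - y} -> f 0 = 0.
Proof. by move=> fB; rewrite -(subrr (0 : V)) fB subrr. Qed.

Lemma right_idealD (R : pzRingType) (I : set R) (a b : R) :
  right_ideal I -> I a -> I b -> I (a + b).
Proof.
move=> [I0 IB _] Ia Ib; rewrite -[b]opprK; apply: (IB) => //.
by rewrite -[- b]sub0r; exact: IB.
Qed.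

Lemma right_ideal_add (R : pzRingType) (I J : set R) :
  right_ideal I -> right_ideal J ->
  right_ideal [set z | exists2 a, I a & J (z - a)].
Proof.
move=> [I0 IB IM] [J0 JB JM]; split.
- by exists 0 => //; rewrite subrr.
- move=> z w [a Ia Ja] [b Ib Jb]; exists (a - b); first exact: IB.
  by have := JB _ _ Ja Jb; rewrite !opprD !opprK addrACA.
- move=> z r [a Ia Ja]; exists (a * r); first exact: IM.
  by rewrite -mulrBl; exact: JM.
Qed.

Lemma right_ideal_principal (R : pzRingType) (a : R) :
  right_ideal [set z | exists r, z = a * r].
Proof.
split; first by exists 0; rewrite mulr0.
- by move=> z w [r ->] [s ->]; exists (r - s); rewrite mulrBr.
- by move=> z s [r ->]; exists (r * s); rewrite mulrA.
Qed.

Section ideals_and_sums.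
Variable R : completeRightLinearRingType.

(** With each of its points [J] contains a whole coset of [I], which is a neighborhood. *)
Lemma open_right_ideal_sub (I J : set R) :
  open_right_ideal I -> right_ideal J -> I `<=` J -> open_right_ideal J.
Proof.
move=> oI idJ IJ; split=> //.
rewrite openE => x Jx; apply: filterS (nbhs_ori x oI) => y /IJ Jyx.
by rewrite -(subrK x y); exact: right_idealD.
Qed.

(** Left multiplication need not preserve [I], so partial sums of [r] are compared modulo the open
    right ideal of all z with a z in [I]. *)
Lemma infsum_mull (X : Type) (a : R) (r : X -> R) : zero_convergent r ->
  a * infsum r = infsum (fun x => a * r x).
Proof.
move=> zr; apply/esym/infsum_unique => I oI.
pose A := fset_set [set x : {classic X} | ~ I (a * r x)].
exists A => B AB; rewrite -mulr_sumr -mulrBr -opprB mulrN -[- _]sub0r.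
have oJ := ori_lmul a oI.
have [_ [I0 IB _]] := oI; apply: IB => //.
apply: (infsum_mod zr oJ) => x nI; apply: (fsubsetP AB).
have fA : finite_set [set x : {classic X} | ~ I (a * r x)] := zr _ oJ.
by rewrite (in_fset_set fA) inE.
Qed.

Lemma infsum_mulr (X : Type) (a : R) (r : X -> R) : zero_convergent r ->
  infsum r * a = infsum (fun x => r x * a).
Proof.
move=> zr; apply/esym/infsum_unique => I oI.
pose A := fset_set [set x : {classic X} | ~ I (r x)].
exists A => B AB; rewrite -mulr_suml -mulrBl -opprB mulNr -[- _]sub0r.
have [_ [I0 IB IM]] := oI; apply: IB => //; apply: IM.
apply: (infsum_mod zr oI) => x nI; apply: (fsubsetP AB).
have fA : finite_set [set x : {classic X} | ~ I (r x)] := zr _ oI.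
by rewrite (in_fset_set fA) inE.
Qed.

End ideals_and_sums.

(** * Free contramodules, homomorphisms and lifting *)

Section free_contramodule.
Variable R : completeRightLinearRingType.

(** Modulo [I] only finitely many [t x] survive, and for each of them only finitely many
    [t x * c x y], so the sums may be exchanged. *)
Lemma infsum_join_exchange (X Y : Type) (t : formal_comb R X)
    (c : X -> formal_comb R Y) (g : Y -> R) :
  infsum (fun y => infsum (fun x => t x * c x y) * g y) =
  infsum (fun x => t x * infsum (fun y => c x y * g y)).
Proof.
have zt (d : X -> R) : zero_convergent (fun x => t x * d x).
  exact: zero_convergent_mulr (coef_zero_convergent t).
transitivity (infsum (fun y => infsum (fun x => t x * c x y * g y))).
  by congr infsum; apply/funext => y; rewrite infsum_mulr.
rewrite infsum_exchange => [|I oI|I oI].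
- congr infsum; apply/funext => x; rewrite infsum_mull.
    by congr infsum; apply/funext => y; rewrite mulrA.
  exact: zero_convergent_mulr (coef_zero_convergent _).
- have [_ [_ _ IM]] := oI.
  apply: (@sub_finite_set _ _
    (\bigcup_(x in [set x | ~ I (t x)]) [set y | ~ I (t x * c x y)])).
    move=> y [x nI]; exists x => [It|Itc]; apply: nI; last exact: IM.
    by rewrite -mulrA; exact: IM.
  apply: bigcup_finite; first exact: (coef_zero_convergent t oI).
  by move=> x _; exact: (coef_zero_convergent (c x) (ori_lmul (t x) oI)).
- have [_ [_ _ IM]] := oI.
  apply: sub_finite_set (coef_zero_convergent t oI) => x [y nI] It.
  by apply: nI; rewrite -mulrA; exact: IM.
Qed.

Lemma infsum_map (X Y : Type) (f : X -> Y) (r : formal_comb R X) (g : Y -> R) :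
  infsum (fun y => comb_map f r y * g y) = infsum (fun x => r x * g (f x)).
Proof.
transitivity
    (infsum (fun y => infsum (fun x => r x * comb_unit R (f x) y) * g y)).
  congr infsum; apply/funext => y /=; congr (infsum _ * _).
  by apply/funext => x; case: ifP => _; rewrite ?mulr1 ?mulr0.
rewrite infsum_join_exchange; congr infsum; apply/funext => x.
rewrite (@infsum1 _ _ _ (f x)) /= => [|y fxy]; first by rewrite asboolT// mul1r.
by rewrite asboolF ?mul0r// => fy; apply: fxy.
Qed.

(** Kleisli extension for R[[-]]: the row [r] times the matrix with rows [g x]. *)
Definition comb_bind (X Y : Type) (g : X -> formal_comb R Y)
    (r : formal_comb R X) : formal_comb R Y :=
  comb_join (comb_map g r).

Lemma comb_bindE (X Y : Type) (g : X -> formal_comb R Y) (r : formal_comb R X)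
    (y : Y) : comb_bind g r y = infsum (fun x => r x * g x y).
Proof. exact: (infsum_map g r (fun s : formal_comb R Y => s y)). Qed.

Lemma contraact_bind (C : contramodule R) (X : Type)
    (g : X -> formal_comb R C) (r : formal_comb R X) :
  contraact (comb_bind g r) = contraact (comb_map (contraact \o g) r).
Proof. by rewrite -contraact_assoc comb_map_comp. Qed.

Lemma comb_join_assoc (X : Type)
    (t : formal_comb R (formal_comb R (formal_comb R X))) :
  comb_join (comb_map (@comb_join R X) t) = comb_join (comb_join t).
Proof.
apply: formal_combP => x.
rewrite [LHS](comb_bindE (@comb_join R X)) /=.
by rewrite (infsum_join_exchange t id (fun s : formal_comb R X => s x)).
Qed.

Definition free_contra (X : Type) : contramodule R :=
  Contramodule (@comb_join_assoc X) (@comb_join_unit R X).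

(** The left-hand sum is defined through the contraaction [comb_join], the right-hand one
    coefficientwise. *)
Lemma free_contraD (X : Type) (r s : free_contra X) :
  r + s = ((r : formal_comb R X) + (s : formal_comb R X)) :> formal_comb R X.
Proof.
by rewrite [LHS](comb_joinD (comb_unit R _) (comb_unit R _)) !comb_join_unit.
Qed.

Definition free_act (C : contramodule R) : contra_hom (free_contra C) C :=
  @ContraHom R (free_contra C) C contraact
    (fun t => esym (contraact_assoc t)).

Lemma contra_hom_coefE (C : contramodule R) (X : Type)
    (f : contra_hom C (free_contra X)) (r : formal_comb R C) (x : X) :
  (f (contraact r) : formal_comb R X) x =
  infsum (fun c => r c * (f c : formal_comb R X) x).
Proof. by rewrite contra_funE; exact: (comb_bindE f r x). Qed.

Lemma comb_bind_unit (X Y : Type) (f : X -> Y) (r : formal_comb R X) :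
  comb_bind (fun x => comb_unit R (f x)) r = comb_map f r.
Proof.
apply: formal_combP => y; rewrite comb_bindE /=.
congr infsum; apply/funext => x.
by case: ifP => _; rewrite ?mulr1 ?mulr0.
Qed.

Lemma comb_bindB (X Y : Type) (g h : X -> formal_comb R Y)
    (r : formal_comb R X) :
  comb_bind (fun x => g x - h x) r = comb_bind g r - comb_bind h r.
Proof.
have zr (d : X -> R) : zero_convergent (fun x => r x * d x).
  exact: zero_convergent_mulr (coef_zero_convergent r).
apply: formal_combP => y; have -> : (comb_bind g r - comb_bind h r) y =
  comb_bind g r y - comb_bind h r y by [].
rewrite !comb_bindE.
rewrite -infsumN// -infsumD//; last exact: zero_convergentN.
by congr infsum; apply/funext => x; rewrite /= mulrBr.
Qed.

Lemma contraactB (C : contramodule R) :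
  {morph @contraact R C : r s / r - s}.
Proof.
by move=> r s; apply/eqP; rewrite -subr_eq opprK -contraactD subrK.
Qed.

Lemma contra_homB (C D : contramodule R) (f : contra_hom C D) :
  {morph f : x y / x - y}.
Proof.
by move=> x y; apply/eqP; rewrite -subr_eq opprK -contra_homD subrK.
Qed.

Lemma contra_hom0 (C D : contramodule R) (f : contra_hom C D) : f 0 = 0.
Proof. exact: morphB0 (contra_homB f). Qed.

Lemma contra_sub_subproof (C D : contramodule R) (f g : contra_hom C D)
    (r : formal_comb R C) :
  f (contraact r) - g (contraact r) =
  contraact (comb_map (fun c => f c - g c) r).
Proof.
rewrite !contra_funE -contraactB -(comb_bind_unit f) -(comb_bind_unit g).
rewrite -comb_bindB contraact_bind.
congr (contraact (comb_map _ r)); apply/funext => c /=.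
by rewrite contraactB !contraact_unit.
Qed.

Definition contra_sub (C D : contramodule R) (f g : contra_hom C D) :
    contra_hom C D := ContraHom (contra_sub_subproof f g).


Lemma zero_convergent_mull (X : Type) (a : R) (r : X -> R) :
  zero_convergent r -> zero_convergent (fun x => a * r x).
Proof. by move=> zr I oI; exact: zr (ori_lmul a oI). Qed.

Definition comb_scale (X : Type) (a : R) (r : formal_comb R X) :
    formal_comb R X :=
  FormalComb (zero_convergent_mull a (coef_zero_convergent r)).

(** The left R-module structure underlying a contramodule. *)
Definition contra_scale (C : contramodule R) (a : R) (c : C) : C :=
  contraact (comb_scale a (comb_unit R c)).

Lemma contra_hom_scale (C : contramodule R) (X : Type)
    (f : contra_hom C (free_contra X)) (x : X) (a : R) (c : C) :
  (f (contra_scale a c) : formal_comb R X) x = a * (f c : formal_comb R X) x.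
Proof.
rewrite contra_hom_coefE (@infsum1 _ _ _ c) /= => [|d dc].
  by rewrite asboolT// mulr1.
by rewrite asboolF ?mulr0 ?mul0r// => cd; apply: dc.
Qed.

Lemma comb_map_scale (X Y : Type) (f : X -> Y) (a : R) (r : formal_comb R X) :
  comb_map f (comb_scale a r) = comb_scale a (comb_map f r).
Proof.
apply: formal_combP => y /=; rewrite infsum_mull; last first.
  exact: zero_convergent_cond.
by congr infsum; apply/funext => x; case: ifP => // _; rewrite mulr0.
Qed.

Lemma contra_homZ (C D : contramodule R) (f : contra_hom C D) (a : R) (c : C) :
  f (contra_scale a c) = contra_scale a (f c).
Proof. by rewrite contra_funE comb_map_scale comb_map_unit. Qed.

Lemma contra_scale0 (C : contramodule R) (a : R) : contra_scale a (0 : C) = 0.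
Proof.
pose r := comb_scale a (comb_unit R (0 : C)).
(* The zero of [C] is by definition the contraaction of the zero combination. *)
transitivity
    (contraact (comb_map (contraact \o fun=> (0 : formal_comb R C)) r)).
  by rewrite comb_map_scale comb_map_unit.
rewrite -contraact_bind; congr contraact; apply: formal_combP => c.
rewrite comb_bindE -[RHS](@infsum0 R C); congr infsum.
by apply/funext => d; exact: mulr0.
Qed.

Lemma contra_hom_coefB (C : contramodule R) (X : Type)
    (f : contra_hom C (free_contra X)) (x : X) (c d : C) :
  (f (c - d) : formal_comb R X) x =
  (f c : formal_comb R X) x - (f d : formal_comb R X) x.
Proof.
apply/eqP; rewrite -subr_eq opprK; apply/eqP.
rewrite -[in RHS](subrK d c) [in RHS]contra_homD.
by rewrite free_contraD.
Qed.

(** The map c |-> (f c)_x d respects infinite sums because right multiplication commutes with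
    [infsum]. *)
Lemma contra_coef_scale_subproof (C D : contramodule R) (X : Type)
    (f : contra_hom C (free_contra X)) (x : X) (d : D) (r : formal_comb R C) :
  contra_scale ((f (contraact r) : formal_comb R X) x) d =
  contraact (comb_map
    (fun c => contra_scale ((f c : formal_comb R X) x) d) r).
Proof.
pose g c := comb_scale ((f c : formal_comb R X) x) (comb_unit R d).
rewrite -[X in contraact (comb_map X r)]/(contraact \o g) -contraact_bind.
congr contraact; apply: formal_combP => y.
rewrite comb_bindE contra_hom_coefE [LHS]/= infsum_mulr.
  by congr infsum; apply/funext => c; rewrite mulrA.
exact: zero_convergent_mulr (coef_zero_convergent r).
Qed.

Definition contra_coef_scale (C D : contramodule R) (X : Type)
    (f : contra_hom C (free_contra X)) (x : X) (d : D) : contra_hom C D :=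
  ContraHom (contra_coef_scale_subproof f x d).

(** Replaces the universal property of a kernel: injectivity of [i] makes the pointwise chosen lift
    a homomorphism. *)
Lemma contra_lift_inj (A B C : contramodule R) (i : contra_hom A B)
    (f : contra_hom C B) : injective i -> (forall c, exists a, i a = f c) ->
  exists g : contra_hom C A, forall c, i (g c) = f c.
Proof.
move=> iI /choice[g gE].
have gH r : g (contraact r) = contraact (comb_map g r).
  apply: iI; rewrite gE !contra_funE comb_map_comp.
  by congr (contraact (comb_map _ r)); apply/funext => c /=; rewrite gE.
by exists (ContraHom gH).
Qed.

Lemma surjective_contra_epi (C D : contramodule R) (e : contra_hom C D) :
  (forall d, exists c, e c = d) -> contra_epi e.
Proof.
move=> eS E g h gh; apply: contra_homP => d; have [c <-] := eS d.
exact: (congr1 (fun k => contra_fun k c) gh).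
Qed.

Lemma contra_projective_lift (P C D : contramodule R) (e : contra_hom C D)
    (f : contra_hom P D) : contra_projective P ->
  (forall d, exists c, e c = d) ->
  exists g : contra_hom P C, forall p, e (g p) = f p.
Proof.
move=> Pproj /surjective_contra_epi/Pproj/(_ f)[g gE]; exists g => p.
exact: (congr1 (fun k => contra_fun k p) gE).
Qed.

(** Makes P a direct summand of a free contramodule; the coordinates of [s] act as a dual basis. *)
Lemma contra_projective_section (P : contramodule R) : contra_projective P ->
  exists s : contra_hom P (free_contra P),
    forall p, contraact (s p : formal_comb R P) = p.
Proof.
move=> Pproj.
have [|s sE] := contra_projective_lift (e := free_act P) (contra_id P) Pproj.
  by move=> p; exists (comb_unit R p); exact: contraact_unit.
by exists s.
Qed.

End free_contramodule.

(** * Computing with elements of the contratensor product *)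

Section contratensor_elements.
Variables (R : completeRightLinearRingType) (N : lmodType R^c).
Hypothesis N_discrete : discrete_module N.

Lemma ractA (b : N) (r s : R) : ract (ract b r) s = ract b (r * s).
Proof. by rewrite /ract scalerA. Qed.

Lemma contratens_ind (C : contramodule R) (P : contratensor N C -> Prop) :
  P 0 -> (forall x y, P x -> P y -> P (x - y)) ->
  (forall b c, P (contratens b c)) -> forall x, P x.
Proof.
move=> P0 PB Pt x; have [t ->] := quotient_pi_surj x.
elim/tensor_ind: t => [|t u Pt' Pu|b c]; last exact: Pt.
- by rewrite raddf0.
- by rewrite raddfB; exact: PB.
Qed.

Lemma contratensor_map_comp0 (A B C : contramodule R) (f : contra_hom A B)
    (g : contra_hom B C) (x : contratensor N A) : (forall a, g (f a) = 0) ->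
  contratensor_map N g (contratensor_map N f x) = 0.
Proof.
have fB := contratensor_mapB N_discrete f.
have gB := contratensor_mapB N_discrete g.
move=> gf; elim/contratens_ind: x => [|x y Hx Hy|b c].
- by rewrite (morphB0 fB) (morphB0 gB).
- by rewrite fB gB Hx Hy subrr.
rewrite !contratensor_mapE// gf /contratens.
have -> : tens b (0 : C) = 0.
  by apply: (addrI (tens b 0)); rewrite -tensDr !addr0.
exact: raddf0.
Qed.

(** The defining relation moves [b] onto the coefficients of [r], all of which it kills. *)
Lemma contratens_act0 (C : contramodule R) (b : N) (r : formal_comb R C) :
  (forall c, ract b (r c) = 0) -> contratens b (contraact r) = 0.
Proof.
move=> br; apply: quotient_pi0; exists (tens b r) => //.
rewrite /contratensor_act /contratensor_expand !tensor_liftE; last first.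
- exact: contratensor_act_biadditive.
- exact: contratensor_expand_biadditive.
rewrite (@contratensor_expand_sum _ _ _ _ _ fset0) => [|c _]; last exact: br.
by rewrite big_seq_fset0 subr0.
Qed.

(** The annihilator of [b] is an open right ideal, so [b] sees only a finite part of a convergent
    sum. *)
Lemma ract_coef_infsum (X : Type) (b : N) (r : formal_comb R X) (g : X -> R)
    (A : {fset {classic X}}) : (forall x, x \notin A -> ract b (r x) = 0) ->
  ract b (infsum (fun x => r x * g x)) =
  \sum_(x <- A) ract (ract b (r x)) (g x).
Proof.
move=> bA; pose h : {classic X} -> R := fun x => r x * g x.
have : annihilator b (infsum h - \sum_(x <- A) h x).
  apply: infsum_mod => //.
    exact: zero_convergent_mulr (coef_zero_convergent r).
  move=> x nb; apply: contrapT => /negP/bA bx; apply: nb.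
  by rewrite /annihilator /= -ractA bx; exact: scaler0.
rewrite /annihilator /= ractBr => /eqP; rewrite subr_eq0 => /eqP ->.
by rewrite ract_sumr; apply: eq_bigr => x _; rewrite ractA.
Qed.

(* b (.) c |-> b (f c)_x is well defined on the contratensor product. *)
Lemma contratens_eq0_coef (C : contramodule R) (X : Type)
    (f : contra_hom C (free_contra R X)) (x : X) (b : N) (c : C) :
  contratens b c = 0 -> ract b ((f c : formal_comb R X) x) = 0.
Proof.
pose u := fun (b : N) (c : C) => ract b ((f c : formal_comb R X) x).
have uD : biadditive u.
  split=> [b1 b2 c1|b1 c1 c2]; first exact: scalerDr.
  by rewrite /u contra_homD free_contraD; exact: scalerDl.
pose U := tensor_lift u.
have UB : {morph U : s t / s - t} := tensor_liftB uD.
have U0 t : range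
    (fun t => @contratensor_act _ N C t - @contratensor_expand _ N C t) t ->
    U t = 0.
  case=> {}t _ <-; rewrite UB.
  pose D t := U (contratensor_act t) - U (contratensor_expand t).
  have DB : {morph D : x y / x - y}.
    move=> y z; rewrite /D /contratensor_act /contratensor_expand.
    rewrite !tensor_liftB ?UB; first last.
    - exact: contratensor_act_biadditive.
    - exact: contratensor_expand_biadditive.
    by rewrite !opprD !opprK addrACA.
  suff : D t = 0 by [].
  elim/tensor_ind: t => [|y z Dy Dz|b' r].
  - exact: morphB0 DB.
  - by rewrite DB Dy Dz subrr.
  rewrite /D /contratensor_act /contratensor_expand !tensor_liftE; first last.
  - exact: contratensor_act_biadditive.
  - exact: contratensor_expand_biadditive.
  (* Discreteness makes the expansion finite; [U] turns it into the action of [b'] on the x-th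
     coordinate of [f (contraact r)]. *)
  have [A bA] := ract_support N_discrete b' r.
  rewrite (contratensor_expand_sum bA) /U tensor_lift_sum// tensor_liftE//.
  rewrite {1}/u contra_hom_coefE.
  rewrite (@ract_coef_infsum _ b' r (fun c => (f c : formal_comb R X) x) A bA).
  apply/eqP; rewrite subr_eq0; apply/eqP; apply: eq_bigr => c' _.
  by rewrite tensor_liftE.
move=> bc; rewrite -[ract _ _]/(u b c) -(tensor_liftE uD).
by rewrite -/U -(quotient_liftE UB U0) -/(contratens b c) bc
  (morphB0 (quotient_liftB UB U0)).
Qed.

End contratensor_elements.

(** * The cyclic right modules R/I *)

Section right_quotient.
Variables (R : pzRingType) (I : set R) (idI : right_ideal I).

(* The unused proof argument lets the R^c-module structure be canonical. *)
Definition right_quotient (_ : right_ideal I) : Type := quotient_by I.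
HB.instance Definition _ := GRing.Zmodule.on (right_quotient idI).

Definition right_quotient_pi (a : R) : right_quotient idI := quotient_pi I a.

Lemma right_quotient_pi_eq0 (a : R) : right_quotient_pi a = 0 <-> I a.
Proof.
rewrite -[0](raddf0 (quotient_pi I)); split=> [/quotient_pi_eq|Ia].
  rewrite subr0 => /asboolP; apply=> //; case: idI => I0 IB _.
  by split.
by rewrite raddf0; exact: quotient_pi0.
Qed.

Let act (a : R) (r : R) : right_quotient idI := right_quotient_pi (a * r).

Let actB r : {morph act^~ r : a b / a - b}.
Proof. by move=> a b; rewrite /act /right_quotient_pi mulrBl raddfB. Qed.

Let act0 r a : I a -> act a r = 0.
Proof. by move=> Ia; apply/right_quotient_pi_eq0; case: idI => _ _; apply. Qed.

Definition right_quotient_scale (r : R^c) (q : right_quotient idI) :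
    right_quotient idI := quotient_lift (act^~ r) q.

Lemma right_quotient_scaleE (r a : R) :
  right_quotient_scale r (right_quotient_pi a) = right_quotient_pi (a * r).
Proof. exact: (quotient_liftE (actB r) (@act0 r)). Qed.

Lemma right_quotient_scaleA (r s : R^c) q :
  right_quotient_scale r (right_quotient_scale s q) =
  right_quotient_scale (r * s) q.
Proof.
have [a ->] := quotient_pi_surj q.
by rewrite -/(right_quotient_pi a) !right_quotient_scaleE -mulrA.
Qed.

Lemma right_quotient_scale1 : left_id 1 right_quotient_scale.
Proof.
move=> q; have [a ->] := quotient_pi_surj q.
by rewrite -/(right_quotient_pi a) right_quotient_scaleE mulr1.
Qed.

Lemma right_quotient_scaleDr : right_distributive right_quotient_scale +%R.
Proof.
move=> r q q'; have [a ->] := quotient_pi_surj q.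
have [b ->] := quotient_pi_surj q'.
rewrite -raddfD -!/(right_quotient_pi _) !right_quotient_scaleE mulrDl.
exact: (raddfD (quotient_pi I)).
Qed.

Lemma right_quotient_scaleDl q :
  {morph right_quotient_scale^~ q : r s / r + s}.
Proof.
move=> r s; have [a ->] := quotient_pi_surj q.
rewrite -!/(right_quotient_pi _) !right_quotient_scaleE mulrDr.
exact: (raddfD (quotient_pi I)).
Qed.

HB.instance Definition _ := GRing.Zmodule_isLmodule.Build R^c
  (right_quotient idI) right_quotient_scaleA right_quotient_scale1
  right_quotient_scaleDr right_quotient_scaleDl.

Lemma ract_right_quotient (a r : R) :
  ract (right_quotient_pi a) r = right_quotient_pi (a * r).
Proof. exact: right_quotient_scaleE. Qed.

End right_quotient.

Lemma right_quotient_discrete (R : completeRightLinearRingType) (I : set R)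
    (idI : right_ideal I) :
  open_right_ideal I -> discrete_module (right_quotient idI).
Proof.
move=> oI q; have [a ->] := quotient_pi_surj q.
have -> : annihilator (quotient_pi I a : right_quotient idI) =
    [set r | I (a * r)]; last exact: ori_lmul.
apply/seteqP; split=> r; rewrite /annihilator /= ract_right_quotient;
  by move/right_quotient_pi_eq0.
Qed.

(** * Nakayama's lemma, kernels of covers, comparison of resolutions *)

Section radical.
Variable R : completeRightLinearRingType.

(* For a right ideal m: R/m is simple or zero. *)
Definition maximal_or_unit (m : set R) : Prop :=
  forall t s, ~ m t -> exists r, m (s - t * r).

(* Nakayama: the coefficients of v generate, modulo I, a finitely generated
   right module V with V = V H, where H is the topological Jacobson radical. *)
Lemma radical_nakayama (X : Type) (v : formal_comb R X)
    (e : X -> formal_comb R X) :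
  (forall y, v y = infsum (fun x => v x * e x y)) ->
  (forall m, open_right_ideal m -> maximal_or_unit m ->
     forall a x y, m (a * e x y)) ->
  forall y, v y = 0.
Proof.
move=> ve eH y; suff vI I : open_right_ideal I -> I (v y).
  apply: ring_separated_subproof => I oI; rewrite /coset_mod.
  have [_ idI] := oI; have [_ IB _] := idI.
  apply/seteqP; split=> z /= Iz.
    by rewrite subr0 -(subrK (v y) z); apply: right_idealD => //; exact: vI.
  by apply: IB; [rewrite -[z]subr0|exact: vI].
move=> oI; apply: contrapT => nIv; have [_ idI] := oI.
(* Zorn's lemma yields a right ideal containing [I], maximal among those missing some coefficient of
   [v]. Taking unions with [I] lets the empty chain be bounded by [I] itself. *)
pose good J := right_ideal J /\ exists y, ~ J (v y).
have [F Fgood Ftot|X0 [[idJ [y0 nJ]] maxJ]] :=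
    @Zorn_bigcup R [set A | good (I `|` A)].
  have step x z : (I `|` \bigcup_(A in F) A) x ->
      (I `|` \bigcup_(A in F) A) z ->
      exists A, [/\ right_ideal (I `|` A), (I `|` A) x, (I `|` A) z &
        I `|` A `<=` I `|` \bigcup_(A in F) A].
    have sub A : F A -> I `|` A `<=` I `|` \bigcup_(A in F) A.
      by move=> FA w [Iw|Aw]; [left|right; exists A].
    move=> [Ix|[A FA Ax]] [Iz|[B FB Bz]].
    - exists set0; split; [by rewrite setU0|by left|by left|].
      by move=> w [Iw|//]; left.
    - exists B; split; [exact: (Fgood _ FB).1|by left|by right|exact: sub].
    - exists A; split; [exact: (Fgood _ FA).1|by right|by left|exact: sub].
    - have [AB|BA] := Ftot _ _ FA FB.
        exists B; split; [exact: (Fgood _ FB).1|right; exact: AB|by right|].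
        exact: sub.
      exists A; split; [exact: (Fgood _ FA).1|by right|right; exact: BA|].
      exact: sub.
  split.
    split; first by left; case: idI.
      move=> a b Ja Jb; have [A [[_ AB _] Aa Ab]] := step a b Ja Jb.
      by apply; exact: AB.
    move=> a r Ja; have [A [[_ _ AM] Aa _]] := step a a Ja Ja.
    by apply; exact: AM.
  apply: contrapT => /forallNP nv.
  have {}nv y' : (I `|` \bigcup_(A in F) A) (v y').
    by apply: contrapT; exact: nv.
  (* Only the finitely many [v x] with x in [D] can lie outside [I], so one member of the chain
     would already absorb all coefficients, which is excluded. *)
  have [D vD] : exists D : {fset {classic X}}, forall x, ~ I (v x) -> x \in D.
    have fD : finite_set [set x : {classic X} | ~ I (v x)].
      exact: (coef_zero_convergent v oI).
    by exists (fset_set [set x : {classic X} | ~ I (v x)]) => x nI;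
      rewrite (in_fset_set fD) inE.
  have [A FA vA] : exists2 A, F A & forall x, x \in D -> (I `|` A) (v x).
    have [A0 FA0 _] : exists2 A, F A & A (v y) by case: (nv y).
    suff [A FA vA] : exists2 A, F A &
        forall x, x \in (D : seq {classic X}) -> (I `|` A) (v x).
      by exists A.
    elim: (D : seq _) => [|x s [A FA vA]]; first by exists A0.
    have [Ix|[B FB Bx]] := nv x.
      by exists A => // z; rewrite inE => /orP[/eqP ->|/vA//]; left.
    have [AB|BA] := Ftot _ _ FA FB.
      exists B => // z; rewrite inE => /orP[/eqP ->|/vA]; first by right.
      by move=> [Iz|/AB]; [left|right].
    exists A => // z; rewrite inE => /orP[/eqP ->|/vA//].
    by right; exact: BA.
  have [_ [x]] := Fgood _ FA; apply.
  by have [Ix|/vD/vA//] := pselect (I (v x)); left.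
set J := I `|` X0 in idJ nJ.
have IJ : I `<=` J by move=> z; left.
have oJ : open_right_ideal J := open_right_ideal_sub oI idJ IJ.
have [J0 JB JM] := idJ.
(* The right ideal J + tR properly contains J, so by maximality it contains every [v x]. *)
have {}maxJ t : ~ J t -> forall x, exists r, J (v x - t * r).
  move=> nJt; pose K := [set z | exists2 a, J a & exists r, z - a = t * r].
  have idK : right_ideal K := right_ideal_add idJ (right_ideal_principal t).
  have JK : J `<=` K.
    by move=> z Jz; exists z => //; exists 0; rewrite mulr0 subrr.
  have Kt : K t by exists 0 => //; exists 1; rewrite subr0 mulr1.
  have := maxJ K; rewrite /=.
  have -> : I `|` K = K by apply/setUidPr => z /IJ/JK.
  move=> nK x; have Kx : K (v x).
    apply: contrapT => nKx; apply: nK; last by split=> //; exists x.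
    split; first by move=> z X0z; apply: JK; right.
    by move=> KX0; apply: nJt; right; exact: KX0.
  by have [a Ja [r ar]] := Kx; exists r; rewrite -ar opprB addrC subrK.
(* R/m is the submodule of R/J generated by the class of [v y0]; it is simple by [maxJ]. *)
pose m := [set r | J (v y0 * r)].
have om : open_right_ideal m := ori_lmul (v y0) oJ.
have mm : maximal_or_unit m.
  move=> t s nmt; have [r Jr] := maxJ _ nmt y0; exists (r * s).
  by rewrite /m /= mulrBr !mulrA -mulrBl; exact: JM.
(* Modulo J each [v x] is some [v y0 * a], and [a * e x y0] lies in [m]; hence every term of the sum
   for [v y0] lies in J. *)
have vJ := maxJ _ nJ; apply: nJ; rewrite ve; apply: infsum_ori => //.
  exact: zero_convergent_mulr (coef_zero_convergent v).
move=> x; have [a Ja] := vJ x.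
rewrite -(subrK (v y0 * a) (v x)) mulrDl; apply: right_idealD => //.
  exact: JM.
by rewrite -mulrA; exact: (eH m om mm).
Qed.

(* If s in R/m is not killed by c(k), where c is the x-th coordinate of f, then
   s (1 - c(k) r) = 0 for some r; but p |-> c(p) r k maps P into the kernel of
   the cover, so 1 - r c(k) is right invertible, hence s c(k) = 0. *)
Lemma cover_kernel_radical (P F : contramodule R) (l : contra_hom P F)
    (X : Type) (f : contra_hom P (free_contra R X)) (k : P) (m : set R) :
  (forall g : contra_hom P P, contra_comp l g = l -> contra_automorphism g) ->
  l k = 0 -> right_ideal m -> maximal_or_unit m ->
  forall a x, m (a * (f k : formal_comb R X) x).
Proof.
move=> l_cover lk [m0 mB mM] mm a x; apply: contrapT => nmt.
pose c p := (f p : formal_comb R X) x; set t := a * _ in nmt.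
have [r mr] := mm t a nmt; pose w := contra_scale r k.
pose phi := contra_coef_scale f x w.
have [|psi [psiK _]] := l_cover (contra_sub (contra_id P) phi).
  apply: contra_homP => p; rewrite /= contra_homB /phi /= contra_homZ.
  by rewrite [w]/(contra_scale r k) contra_homZ lk !contra_scale0 subr0.
have psiw : psi w - contra_scale (c w) (psi w) = w.
  rewrite -contra_homZ -contra_homB.
  exact: (congr1 (fun g => contra_fun g w) psiK).
have cw : c w = r * c k by rewrite /c contra_hom_scale.
(* Applying c to [psiw] gives c(psi w) - c(w) c(psi w) = c(w). *)
have inv : (1 - c w) * (1 + c (psi w)) = 1.
  have := congr1 c psiw; rewrite /c contra_hom_coefB contra_hom_scale -!/(c _).
  by move=> E; rewrite mulrDr mulr1 mulrBl mul1r E subrK.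
(* Since c(w) = r c(k), multiplying a - t r by c(k) puts t (1 - c(w)) in [m]. *)
have := mM _ (c k) mr => mrk; apply: nmt.
rewrite -[t]mulr1 -inv mulrA; apply: mM; move: mrk.
by rewrite mulrBl -/t -mulrA -cw mulrBr mulr1.
Qed.

(* Injectivity of N (.) K -> N (.) P for K = T_1 = ker (T_0 -> F), on pure
   tensors: compare P with T_0 through the resolution Q computing Ctrtor_1. *)
Lemma Ctrtor1_contratens_eq0 (F P : contramodule R) (l : contra_hom P F)
    (T Q : projective_resolution F) (N : lmodType R^c)
    (f : contra_hom P (T 0%N))
    (b : N) (k : P) (t : T 1%N) :
  discrete_module N -> contra_projective P ->
  (forall x : contratensor N (Q 1%N),
     contratensor_cycle x -> contratensor_boundary x) ->
  injective (res_diff T 0) -> (forall p, res_aug T (f p) = l p) ->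
  l k = 0 -> res_diff T 0 t = f k -> contratens b k = 0 -> contratens b t = 0.
Proof.
move=> dN Pproj Qexact dinj fl lk dt bk.
(* Comparison maps over F: [f'] from P to Q_0 and [g] from Q_0 to T_0. The defect f - g f' factors
   through T_1 as [h], and [theta] extends [g] to degree 1. *)
have [f' f'E] := contra_projective_lift l Pproj (res_aug_surj Q).
have [g gE] := contra_projective_lift (res_aug Q) (@res_projective _ _ Q 0)
  (res_aug_surj T).
have [h hE] : exists h : contra_hom P (T 1%N),
    forall p, res_diff T 0 (h p) = f p - g (f' p).
  apply: (contra_lift_inj (f := contra_sub f (contra_comp g f')) dinj) => p.
  by apply/res_exact0; rewrite contra_homB /= fl gE f'E subrr.
have [theta thetaE] : exists theta : contra_hom (Q 1%N) (T 1%N),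
    forall q, res_diff T 0 (theta q) = g (res_diff Q 0 q).
  apply: (contra_lift_inj (f := contra_comp g (res_diff Q 0)) dinj) => q.
  by apply/res_exact0; rewrite /= gE; apply/res_exact0; exists q.
have [q qE] : exists q, res_diff Q 0 q = f' k.
  by apply/res_exact0; rewrite f'E.
have -> : t = theta q + h k.
  by apply: dinj; rewrite dt contra_homD thetaE hE qE addrC subrK.
(* The differential sends b (.) q to b (.) f'(k), the image of b (.) k = 0. *)
have [y yE] : contratensor_boundary (contratens b q).
  apply: Qexact; rewrite /= contratensor_mapE// qE -contratensor_mapE// bk.
  exact: morphB0 (contratensor_mapB dN f').
(* [theta] kills boundaries: d theta d = g d d = 0, and the differential of T is injective. *)
have theta0 : contratens b (theta q) = 0.
  rewrite -contratensor_mapE// -yE; apply: contratensor_map_comp0 => // z.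
  apply: dinj; rewrite thetaE contra_hom0.
  have -> : res_diff Q 0 (res_diff Q 1 z) = 0 by apply/res_exactS; exists z.
  exact: contra_hom0.
have h0 : contratens b (h k) = 0.
  rewrite -contratensor_mapE// bk.
  exact: morphB0 (contratensor_mapB dN h).
rewrite /contratens tensDr raddfD -!/(contratens _ _).
by rewrite [X in X + _]theta0 [X in _ + X]h0 addr0.
Qed.

End radical.

(** * Vanishing of the kernel of the cover *)

Theorem theorem3p1 (R : completeRightLinearRingType) (F : contramodule R)
    (F_flat : infinitely_strictly_flat F)
    (F_pd : projective_dimension_le F 1)
    (F_cover : has_projective_cover F) :
  contra_projective F.
Proof.
have [P [l [[Pproj l_precover] l_cover]]] := F_cover.
have [T Tlen] := F_pd.
(* As T_2 = 0, T_1 is the kernel of the augmentation. *)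
have dinj : injective (res_diff T 0).
  move=> x y xy; apply/eqP; rewrite -subr_eq0; apply/eqP.
  have /res_exactS[z <-] : res_diff T 0 (x - y) = 0.
    by rewrite contra_homB xy subrr.
  by rewrite (Tlen 2%N isT z) contra_hom0.
have [g gE] : exists g : contra_hom (T 0%N) P, forall t, l (g t) = res_aug T t.
  have [g gE] := l_precover _ (res_aug T) (@res_projective _ _ T 0).
  by exists g => t; exact: (congr1 (fun k => contra_fun k t) gE).
have l_surj x : exists p, l p = x.
  by have [t <-] := res_aug_surj T x; exists (g t).
(* Any lift [f0] gives l g f0 = l, so g f0 is an automorphism; correcting [f0] by its inverse makes
   P a direct summand of T_0 over F. *)
have [f fE fK] : exists2 f : contra_hom P (T 0%N),
    (forall p, res_aug T (f p) = l p) & (forall p, g (f p) = p).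
  have [f0 f0E] := contra_projective_lift l Pproj (res_aug_surj T).
  have [|al [_ alK]] := l_cover (contra_comp g f0).
    by apply: contra_homP => p /=; rewrite gE f0E.
  have {}alK p : g (f0 (al p)) = p := congr1 (fun k => contra_fun k p) alK.
  exists (contra_comp f0 al) => p /=; last exact: alK.
  by rewrite f0E -[in RHS](alK p) gE f0E.
have [s sE] := contra_projective_section Pproj.
have [s1 s1E] := contra_projective_section (@res_projective _ _ T 1).
(* The restriction of the idempotent f g to T_1; its image is a copy of the kernel of [l], which is
   thus handled without being constructed. *)
have [e eE] : exists e : contra_hom (T 1%N) (T 1%N),
    forall t, res_diff T 0 (e t) = f (g (res_diff T 0 t)).
  apply: (contra_lift_inj
    (f := contra_comp f (contra_comp g (res_diff T 0))) dinj) => t /=.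
  by apply/res_exact0; rewrite fE gE; apply/res_exact0; exists t.
have eH (m : set R) (a : R) t y : open_right_ideal m -> maximal_or_unit m ->
    m (a * (s1 (e t) : formal_comb R (T 1%N)) y).
  move=> om mm; have [_ idm] := om; pose N : lmodType R^c := right_quotient idm.
  have dN : discrete_module N := right_quotient_discrete (idI := idm) om.
  have [Q Qexact] := F_flat 1%N isT N dN 1%N isT.
  pose b : N := right_quotient_pi idm a; pose k := g (res_diff T 0 t).
  have lk : l k = 0 by rewrite gE; apply/res_exact0; exists t.
  apply/(right_quotient_pi_eq0 idm); rewrite -ract_right_quotient.
  apply: contratens_eq0_coef => //.
  apply: (Ctrtor1_contratens_eq0 dN Pproj Qexact dinj fE lk (eE t)).
  (* The coordinates of [k] along the section [s] are killed by R/m, so b (.) k = 0. *)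
  rewrite -(sE k); apply: contratens_act0 => // x.
  rewrite ract_right_quotient; apply/right_quotient_pi_eq0.
  exact: cover_kernel_radical l_cover lk idm mm a x.
have l_inj : injective l.
  move=> p p' lp; apply/eqP; rewrite -subr_eq0; apply/eqP.
  have : l (p - p') = 0 by rewrite contra_homB lp subrr.
  move: (p - p') => {p lp}p' lp; have /res_exact0[t tE] : res_aug T (f p') = 0.
    by rewrite fE.
  have et : e t = t by apply: dinj; rewrite eE tE fK.
  suff t0 : t = 0 by rewrite -(fK p') -tE t0 !contra_hom0.
  (* Since e t = t, the row [v] of coordinates is fixed by the matrix with rows [s1 (e x)], whose
     entries [eH] controls. *)
  pose v : formal_comb R (T 1%N) := s1 t.
  rewrite -(s1E t); congr contraact; apply: formal_combP => y.
  apply: (@radical_nakayama _ _ v (fun x => s1 (e x))).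
    move=> y'; rewrite {1}/v -et -(s1E t).
    exact: (contra_hom_coefE (contra_comp s1 e)).
  by move=> m om mm a x y'; exact: eH.
(* Now [l] is bijective, and its inverse carries projectivity from P to F. *)
move=> C D c /[dup] cepi _ h.
have [j jE] := contra_lift_inj (f := contra_id F) l_inj l_surj.
have [u uE] := Pproj C D c cepi (contra_comp h l).
exists (contra_comp u j); apply: contra_homP => x /=.
have /= -> := congr1 (fun k => contra_fun k (j x)) uE.
by rewrite jE.
Qed.
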